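(* Let $p_\star=\frac{d\pi_\star}{d(\mu\otimes\nu)}$ and let $p_n$ be its empirical analog, canonically extended to $\mathbb{R}^d\times\mathbb{R}^d$. Then $$\mathbb{E}\|p_n-p_\star\|_{L^2(\mu\otimes\nu)}^2\lesssim\frac1n .$$ Moreover, for all $t>0$, with probability at least $1-16e^{-t}$, it holds $$\|p_n-p_\star\|_{L^2(\mu_n\otimes\nu_n)}^2\lesssim\frac tn\qquad\text{and}\qquad \|p_n-p_\star\|_{L^2(\mu\otimes\nu)}^2\lesssim\frac tn .$$
   Context: Fix $d\ge 1$, $n \ge 1$, $\eta>0$, and probability measures $\mu,\nu$ on $\mathbb{R}^d$ such that $\|x\|\le 1/2$ for $\mu$-almost every $x$ and $\|y\|\le 1/2$ for $\nu$-almost every $y$ (Euclidean norm). Let $X_1,\dots,X_n\sim\mu$ i.i.d. and $Y_1,\dots,Y_n\sim\nu$ i.i.d., the two samples being mutually independent, and let $\mu_n=\frac1n\sum_{i=1}^n\delta_{X_i}$, $\nu_n=\frac1n\sum_{j=1}^n\delta_{Y_j}$. The Schrödinger coupling is $$\pi_\star=\operatorname{argmin}_{\pi\in\Pi(\mu,\nu)}\Big\{\int\|x-y\|^2d\pi+\frac1\eta\mathsf{KL}(\pi\|\mu\otimes\nu)\Big\},$$ where $\Pi(\mu,\nu)$ is the set of couplings of $\mu,\nu$ (it exists and is unique). Its density satisfies $p_\star(x,y)=e^{-\eta(\|x-y\|^2-f_\star(x)-g_\star(y))}$, where $(f_\star,g_\star)\in L^\infty(\mu)\times L^\infty(\nu)$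 is the unique pair of optimal dual potentials, i.e. maximizers of $\Phi(f,g)=\int f\,d\mu+\int g\,d\nu-\frac1\eta\int e^{-\eta(\|x-y\|^2-f(x)-g(y))}d(\mu\otimes\nu)+\frac1\eta$, with $\int g_\star\,d\nu=0$. Empirical dual potentials: $(f_n,g_n)$ is the unique maximizer over $L^\infty(\mu_n)\times L^\infty(\nu_n)$ of $$\Phi_n(f,g)=\int f\,d\mu_n+\int g\,d\nu_n-\frac1\eta\int e^{-\eta(\|x-y\|^2-f(x)-g(y))}\,d(\mu_n\otimes\nu_n)+\frac1\eta$$ such that $\int g_n\,d\nu_n=0$. They are extended to all of $\mathbb{R}^d$ (canonical extension) by $$e^{-\eta f_n(x)}=\frac1n\sum_{j=1}^n e^{-\eta\|x-Y_j\|^2+\eta g_n(Y_j)},\qquad e^{-\eta g_n(y)}=\frac1n\sum_{i=1}^n e^{-\eta\|X_i-y\|^2+\eta f_n(X_i)}.$$ The extended $p_n$ is $p_n(x,y)=e^{-\eta(\|x-y\|^2-f_n(x)-g_n(y))}$ for $x,y\in\mathbb{R}^d$; on the samples it is the density with respect to $\mu_n\otimes\nu_n$ of the empirical Schrödinger coupling. The notation $A\lesssim B$ means $A\le cB$ for a constant $c=c(\eta)$ depending only on $\eta$. *)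

(* Defs.v *)
From HB Require Import structures.
From mathcomp Require Import all_boot all_order all_algebra.
From mathcomp Require Import all_classical all_reals all_analysis.
Import Order.TTheory GRing.Theory Num.Theory.
Import numFieldNormedType.Exports.

Set Implicit Arguments.
Unset Strict Implicit.
Unset Printing Implicit Defensive.

Local Open Scope classical_set_scope.
Local Open Scope ring_scope.

(* R^d is [d.-tuple R], whose sigma-algebra is the product (= Borel) one. *)
Definition enorm (R : realType) (d : nat) (x : d.-tuple R) : R :=
  Num.sqrt (\sum_(i < d) tnth x i ^+ 2).

Definition sqdist (R : realType) (d : nat) (x y : d.-tuple R) : R :=
  enorm [tuple tnth x i - tnth y i | i < d] ^+ 2.

Section empirical_measure.
Context {disp : measure_display} {T : measurableType disp} {R : realType}.
Variables (n : nat) (x : 'I_n -> T).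

Definition empirical (A : set T) : \bar R :=
  ((n%:R^-1)%:E * \sum_(i < n) \d_(x i) A)%E.

Let atom (k : nat) : {measure set T -> \bar R} :=
  if insub k is Some i then \d_(x i) else mzero.

Let empiricalE :
  empirical = mscale ((n%:R^-1)%:nng : {nonneg R}) (msum atom n).
Proof.
apply/funext => A; rewrite /empirical /mscale /msum /=; congr (_ * _)%E.
by apply: eq_bigr => i _; rewrite /atom valK.
Qed.

Let empirical0 : empirical set0 = 0%E.
Proof. by rewrite empiricalE measure0. Qed.

Let empirical_ge0 A : (0 <= empirical A)%E.
Proof. by rewrite empiricalE measure_ge0. Qed.

Let empirical_sigma_additive : semi_sigma_additive empirical.
Proof. by rewrite empiricalE; exact: measure_semi_sigma_additive. Qed.

HB.instance Definition _ := isMeasure.Build _ _ _ empirical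
  empirical0 empirical_ge0 empirical_sigma_additive.

Let empirical_fin : fin_num_fun empirical.
Proof.
move=> A mA; rewrite /empirical fin_numM// sum_fin_num; apply/allP => r.
by case/mapP => i _ ->; rewrite /= diracE.
Qed.

HB.instance Definition _ := Measure_isFinite.Build _ _ _ empirical
  empirical_fin.

End empirical_measure.

(* Mutual independence: the product rule over every finite subfamily. *)
Definition mutually_independent (dO dT : measure_display)
    (Omega : measurableType dO) (T : measurableType dT) (R : realType)
    (P : probability Omega R) (I : finType) (Z : I -> {RV P >-> T}) : Prop :=
  forall (J : {set I}) (A : I -> set T), (forall i, measurable (A i)) ->
    P [set w | forall i, i \in J -> A i (Z i w)] =
    (\prod_(i in J) P (Z i @^-1` A i))%E.

Definition two_samples (A : Type) (n : nat) (X Y : 'I_n -> A)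
    (k : 'I_n + 'I_n) : A :=
  match k with inl i => X i | inr j => Y j end.

Definition has_law (dO dT : measure_display)
    (Omega : measurableType dO) (T : measurableType dT) (R : realType)
    (P : probability Omega R) (X : {RV P >-> T}) (mu : probability T R) : Prop :=
  forall A, measurable A -> distribution P X A = mu A.

(* The divergence is +oo without absolute continuity; otherwise the integral is
   well defined in \bar R since s |-> s * ln s is bounded below. *)
Definition KL (disp : measure_display) (T : measurableType disp)
    (R : realType) (p q : probability T R) : \bar R :=
  if `[< p `<< q >] then
    (\int[p]_z lne (Radon_Nikodym (charge_of_finite_measure p) q z))%E
  else +oo%E.

Section schrodinger.
Context {R : realType} {d : nat}.
Notation V := (d.-tuple R).
Implicit Types mu nu : probability V R.
Implicit Types pi : probability (V * V)%type R.

Definition coupling mu nu pi : Prop :=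
  forall A : set V, measurable A ->
    pi (A `*` setT) = mu A /\ pi (setT `*` A) = nu A.

Definition eot_cost (eta : R) mu nu pi : \bar R :=
  (\int[pi]_z (sqdist z.1 z.2)%:E + (eta^-1)%:E * KL pi (mu \x nu))%E.

Definition schrodinger_coupling (eta : R) mu nu pi : Prop :=
  coupling mu nu pi /\
  forall pi', coupling mu nu pi' ->
    (eot_cost eta mu nu pi <= eot_cost eta mu nu pi')%E.

Definition schrodinger_density mu nu pi (z : V * V) : R :=
  fine (Radon_Nikodym (charge_of_finite_measure pi)
    ((mu \x nu)%E : probability (V * V)%type R) z).

Definition dual_objective (eta : R)
    (mu nu : {finite_measure set V -> \bar R}) (f g : V -> R) : R :=
  \int[mu]_x f x + \int[nu]_y g y
  - eta^-1 * \int[(mu \x nu)%E]_z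
                expR (- eta * (sqdist z.1 z.2 - f z.1 - g z.2))
  + eta^-1.

Definition dual_maximizer (eta : R)
    (mu nu : {finite_measure set V -> \bar R}) (f g : V -> R) : Prop :=
  [/\ f \in Lfun mu +oo%E, g \in Lfun nu +oo%E &
    forall f' g' : V -> R, f' \in Lfun mu +oo%E -> g' \in Lfun nu +oo%E ->
      dual_objective eta mu nu f' g' <= dual_objective eta mu nu f g].

(* The last two clauses hold at the sample points for any maximizer; elsewhere
   they define the values of f and g (canonical extension). *)
Definition empirical_potentials (eta : R) (n : nat) (x y : 'I_n -> V)
    (f g : V -> R) : Prop :=
  [/\ dual_maximizer eta (empirical x) (empirical y) f g,
      \int[empirical y]_z g z = 0,
      (forall u, expR (- eta * f u) =
        n%:R^-1 * \sum_(j < n) expR (- eta * sqdist u (y j) + eta * g (y j))) &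
      (forall v, expR (- eta * g v) =
        n%:R^-1 * \sum_(i < n) expR (- eta * sqdist (x i) v + eta * f (x i)))].

Definition gibbs_density (eta : R) (f g : V -> R) (z : V * V) : R :=
  expR (- eta * (sqdist z.1 z.2 - f z.1 - g z.2)).

End schrodinger.

Definition L2_dist_sq (disp : measure_display) (T : measurableType disp)
    (R : realType) (m : {measure set T -> \bar R}) (f g : T -> R) : \bar R :=
  (Lnorm m 2%:E (fun z => (f z - g z)%:E) ^+ 2)%E.

(* Main.v *)
From HB Require Import structures.
Require Import Defs.
From mathcomp Require Import all_boot all_order all_algebra.
From mathcomp Require Import all_classical all_reals all_analysis.
From mathcomp Require Import ring lra measurable_realfun.
Import Order.TTheory GRing.Theory Num.Theory.
Import numFieldNormedType.Exports.

(** Write c for the squared distance, which is at most 1 on the common support,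
and z = 1 - q, where q is the density of the Schrodinger coupling.  The proof
has a variational, a deterministic and a probabilistic part.

Variational part.  The Sinkhorn iteration contracts the projective (Hilbert)
distance, so the Schrodinger system has a solution: potentials f0 and g0,
bounded everywhere by constants free of d, such that
q(x,y) = exp(-eta (c(x,y) - f0(x) - g0(y))) integrates to 1 in each variable
([schrodinger_potentials]).  For any coupling pi the transport cost equals a
constant minus eta^-1 times the integral of ln q against pi; comparing the
optimal coupling with the one of density q therefore bounds the relative
entropy of the former by the integral of ln q, and this forces its density to
be q ([KL_le_density], [schrodinger_densityE]).

Deterministic part.  Let the sample lie in the support.  The empirical dual
problem is strongly concave on the range of the bounded potentials, and (f0,g0)
satisfies its optimality conditions up to the errors
n^-1 sum_j z(X_i,Y_j) and n^-1 sum_i z(X_i,Y_j).  Hence the potentials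
(f_n,g_n) and (f0,g0), after a shift by a constant, differ on the sample by at
most a multiple of these errors, and the canonical extension carries the bound
to every point (u,v) of the support, at the price of the errors
n^-1 sum_j z(u,Y_j) and n^-1 sum_i z(X_i,v) ([density_stability]).  Integrating
the square bounds both losses by four mean square deviations: the errors
squared and averaged over the other sample, or over mu and nu.

Probabilistic part.  Since z is bounded and integrates to 0 in each variable,
each deviation is a quadratic form with a positive semidefinite, completely
degenerate kernel in n independent variables.  Adding one variable at a time,
with an exponent that decreases along the way, gives
E exp(n U / (32 b^2)) <= 2 for each deviation U, where b bounds |z|
([exponential_moment]).  Both the mean of order 1/n and the tail 2 exp(-t)
follow, and a union bound over the four deviations concludes.

No measurability of the losses in the outcome is needed: they are compared
with the measurable deviations outside a null set, and the integral of a
nonnegative function is monotone without measurability of the smaller one. *)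

Local Open Scope classical_set_scope.
Local Open Scope ring_scope.

Set Implicit Arguments.
Unset Strict Implicit.
Unset Printing Implicit Defensive.

(** * Bounded measurable functions and their integrals *)

Section bounded_measurable.
Context {d : measure_display} {T : measurableType d} {R : realType}.
Implicit Types f g : T -> R.

(** Bounded measurable functions, the bound holding everywhere; they form an
algebra of functions integrable for every probability measure. *)
Definition bmeas f := measurable_fun [set: T] f /\ exists M, forall x, `|f x| <= M.

Lemma bmeas_cst (r : R) : bmeas (fun=> r).
Proof. by split; [exact: measurable_cst|exists `|r|]. Qed.

Lemma bmeasD f g : bmeas f -> bmeas g -> bmeas (fun x => f x + g x).
Proof.
move=> [mf [M fM]] [mg [N gN]]; split; first exact: measurable_funD.
by exists (M + N) => x; rewrite (le_trans (ler_normD _ _))// lerD.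
Qed.

Lemma bmeasM f g : bmeas f -> bmeas g -> bmeas (fun x => f x * g x).
Proof.
move=> [mf [M fM]] [mg [N gN]]; split; first exact: measurable_funM.
by exists (M * N) => x; rewrite normrM ler_pM.
Qed.

Lemma bmeasN f : bmeas f -> bmeas (fun x => - f x).
Proof.
move=> [mf [M fM]]; split; first exact: measurableT_comp.
by exists M => x; rewrite normrN.
Qed.

Lemma bmeasB f g : bmeas f -> bmeas g -> bmeas (fun x => f x - g x).
Proof. by move=> bf bg; apply: bmeasD => //; exact: bmeasN. Qed.

Lemma bmeas_sum (I : Type) (s : seq I) (F : I -> T -> R) :
  (forall i, bmeas (F i)) -> bmeas (fun x => \sum_(i <- s) F i x).
Proof.
move=> bF; elim: s => [|i s IH].
  by under eq_fun do rewrite big_nil; exact: bmeas_cst.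
by under eq_fun do rewrite big_cons; exact: bmeasD.
Qed.

Lemma bmeasX f n : bmeas f -> bmeas (fun x => f x ^+ n).
Proof.
move=> bf; elim: n => [|n IH]; first exact: bmeas_cst.
by under eq_fun do rewrite exprS; exact: bmeasM.
Qed.

Lemma bmeas_expR f : bmeas f -> bmeas (fun x => expR (f x)).
Proof.
move=> [mf [M fM]]; split; first exact: measurableT_comp.
exists (expR M) => x; rewrite ger0_norm ?expR_ge0// ler_expR.
by rewrite (le_trans (ler_norm _)).
Qed.

Lemma bmeas_between f (a b : R) :
  measurable_fun [set: T] f -> (forall x, a <= f x <= b) -> bmeas f.
Proof.
move=> mf h; split => //; exists (`|a| + `|b|) => x.
case/andP: (h x) => h1 h2; rewrite ler_norml; apply/andP; split.
  by rewrite (le_trans _ h1)// opprD ler_wnDr// ?oppr_le0// lerNl -normrN ler_norm.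
by rewrite (le_trans h2)// ler_wpDl// ler_norm.
Qed.

Lemma bmeas_inv f (a : R) : 0 < a -> measurable_fun [set: T] f ->
  (forall x, a <= f x) -> bmeas (fun x => (f x)^-1).
Proof.
move=> a0 mf h; split.
  (* the inverse of a positive real is expR (- ln _) *)
  rewrite (_ : (fun x => _) = fun x => expR (- ln (f x))).
    apply: measurableT_comp => //; apply: measurableT_comp => //.
    exact: measurableT_comp.
  apply/funext => x; rewrite expRN lnK// posrE.
  exact: lt_le_trans (h x).
exists a^-1 => x; have fx0 : 0 < f x by rewrite (lt_le_trans a0).
by rewrite gtr0_norm ?invr_gt0// lef_pV2.
Qed.

End bounded_measurable.

Lemma bmeas_comp d1 d2 (T1 : measurableType d1) (T2 : measurableType d2)
    (R : realType) (f : T2 -> R) (h : T1 -> T2) :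
  bmeas f -> measurable_fun [set: T1] h -> bmeas (f \o h).
Proof.
move=> [mf [M fM]] mh; split; first exact: measurableT_comp.
by exists M => x; exact: fM.
Qed.

Section bounded_Rintegral.
Context {d : measure_display} {T : measurableType d} {R : realType}.
Variable mu : probability T R.
Implicit Types f g : T -> R.

Lemma bmeas_integrable f : bmeas f -> mu.-integrable [set: T] (EFin \o f).
Proof.
move=> [mf [M fM]]; apply: measurable_bounded_integrable => //.
  by rewrite (le_lt_trans (probability_le1 mu measurableT))// ltry.
exists M; split; first exact: num_real.
by move=> x Mx y _ /=; rewrite (le_trans (fM y))// ltW.
Qed.

Lemma EFin_bRintegral f : bmeas f ->
  (\int[mu]_x f x)%:E = (\int[mu]_x (f x)%:E)%E.
Proof.
by move=> bf; rewrite fineK//; exact/integrable_fin_num/bmeas_integrable.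
Qed.

Lemma bRintegralD f g : bmeas f -> bmeas g ->
  \int[mu]_x (f x + g x) = \int[mu]_x f x + \int[mu]_x g x.
Proof. by move=> bf bg; rewrite RintegralD//; exact: bmeas_integrable. Qed.

Lemma bRintegralB f g : bmeas f -> bmeas g ->
  \int[mu]_x (f x - g x) = \int[mu]_x f x - \int[mu]_x g x.
Proof. by move=> bf bg; rewrite RintegralB//; exact: bmeas_integrable. Qed.

Lemma bRintegralZl (r : R) f : bmeas f ->
  \int[mu]_x (r * f x) = r * \int[mu]_x f x.
Proof. by move=> bf; rewrite RintegralZl//; exact: bmeas_integrable. Qed.

Lemma bRintegralZr (r : R) f : bmeas f ->
  \int[mu]_x (f x * r) = (\int[mu]_x f x) * r.
Proof. by move=> bf; rewrite RintegralZr//; exact: bmeas_integrable. Qed.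

Lemma bRintegral_cst (r : R) : \int[mu]_x r = r.
Proof. transitivity (r * fine 1%E); last by rewrite mulr1.
by rewrite Rintegral_cst//; congr (_ * fine _); exact: probability_setT. Qed.

Lemma le_bRintegral f g : bmeas f -> bmeas g -> (forall x, f x <= g x) ->
  \int[mu]_x f x <= \int[mu]_x g x.
Proof.
by move=> bf bg fg; apply: le_Rintegral => //; exact: bmeas_integrable.
Qed.

Lemma bRintegral_between (a b : R) f : bmeas f -> (forall x, a <= f x <= b) ->
  a <= \int[mu]_x f x <= b.
Proof.
move=> bf h; rewrite -[X in X <= _ <= _](bRintegral_cst a).
rewrite -[X in _ <= _ <= X](bRintegral_cst b).
by apply/andP; split; apply: le_bRintegral => //;
  try exact: bmeas_cst; move=> x; case/andP: (h x).
Qed.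

Lemma bRintegral_sum (I : Type) (s : seq I) (F : I -> T -> R) :
  (forall i, bmeas (F i)) ->
  \int[mu]_x (\sum_(i <- s) F i x) = \sum_(i <- s) \int[mu]_x F i x.
Proof.
move=> bF; elim: s => [|i s IH].
  by rewrite big_nil; under eq_Rintegral do rewrite big_nil; rewrite bRintegral_cst.
rewrite big_cons -IH -bRintegralD//; last exact: bmeas_sum.
by apply: eq_Rintegral => x _; rewrite big_cons.
Qed.

End bounded_Rintegral.

Section bounded_Fubini.
Context {d1 d2 : measure_display} {T1 : measurableType d1}
  {T2 : measurableType d2} {R : realType}.
Variables (mu : probability T1 R) (nu : probability T2 R).
Implicit Types k : T1 * T2 -> R.

Lemma bmeas_sectionl k x : bmeas k -> bmeas (fun y => k (x, y)).
Proof.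
by move=> bk; apply: (@bmeas_comp _ _ _ _ _ k (pair x)) => //; exact: measurable_pair1.
Qed.

Lemma bmeas_sectionr k y : bmeas k -> bmeas (fun x => k (x, y)).
Proof.
by move=> bk; apply: (@bmeas_comp _ _ _ _ _ k (pair^~ y)) => //; exact: measurable_pair2.
Qed.

Lemma bmeas_Rintegral k : bmeas k -> bmeas (fun x => \int[nu]_y k (x, y)).
Proof.
move=> bk; have [mk [M kM]] := bk.
apply: (@bmeas_between _ _ _ _ (- M) M); last first.
  move=> x; apply: bRintegral_between; first exact: bmeas_sectionl.
  by move=> y; rewrite -ler_norml.
apply/measurable_EFinP.
rewrite (_ : _ \o _ = fubini_F nu (EFin \o k)); last first.
  by apply/funext => x /=; rewrite EFin_bRintegral//; exact: bmeas_sectionl.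
apply: measurable_fubini_F; exact: (bmeas_integrable (mu \x nu)%E bk).
Qed.

Lemma bmeas_Rintegralr k : bmeas k -> bmeas (fun y => \int[mu]_x k (x, y)).
Proof.
move=> bk; have [mk [M kM]] := bk.
apply: (@bmeas_between _ _ _ _ (- M) M); last first.
  move=> y; apply: bRintegral_between; first exact: bmeas_sectionr.
  by move=> x; rewrite -ler_norml.
apply/measurable_EFinP.
rewrite (_ : _ \o _ = fubini_G mu (EFin \o k)); last first.
  by apply/funext => x /=; rewrite EFin_bRintegral//; exact: bmeas_sectionr.
apply: measurable_fubini_G; exact: (bmeas_integrable (mu \x nu)%E bk).
Qed.

Lemma bFubini k : bmeas k ->
  \int[mu]_x \int[nu]_y k (x, y) = \int[nu]_y \int[mu]_x k (x, y).
Proof.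
move=> bk; apply: EFin_inj.
rewrite EFin_bRintegral; last exact: bmeas_Rintegral.
rewrite EFin_bRintegral; last exact: bmeas_Rintegralr.
under eq_integral do rewrite (EFin_bRintegral _ (bmeas_sectionl _ bk)).
under [RHS]eq_integral do rewrite (EFin_bRintegral _ (bmeas_sectionr _ bk)).
exact: (Fubini (bmeas_integrable (mu \x nu)%E bk)).
Qed.

End bounded_Fubini.

(** * The Schrodinger system *)

Section half_step.
Context {d1 d2 : measure_display} {T1 : measurableType d1}
  {T2 : measurableType d2} {R : realType}.
Variables (nu : probability T2 R) (k : T1 * T2 -> R) (kap : R).
Hypotheses (kap_gt0 : 0 < kap) (mk : measurable_fun [set: T1 * T2] k)
  (k_bnd : forall z, kap <= k z <= 1).

(** The integral operator with kernel [k]. *)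
Definition kernel_int (b : T2 -> R) (x : T1) : R := \int[nu]_y (k (x, y) * b y).

(** The oscillation of [b1 / b2] is at most [D], that is, the projective
distance between [b1] and [b2] is at most [ln D]; written without division. *)
Definition ratio_le (T : Type) (D : R) (b1 b2 : T -> R) :=
  forall y y', b1 y * b2 y' <= D * (b1 y' * b2 y).

Lemma bmeas_kernel : bmeas k.
Proof. exact: bmeas_between mk k_bnd. Qed.

Lemma bmeas_kernelM b x : bmeas b -> bmeas (fun y => k (x, y) * b y).
Proof. by move=> bb; apply: bmeasM => //; exact/bmeas_sectionl/bmeas_kernel. Qed.

Lemma kernel_int_ge (l : R) b x : 0 <= l -> bmeas b -> (forall y, l <= b y) ->
  kap * l <= kernel_int b x.
Proof.
move=> l0 bb lb; rewrite -[X in X <= _](bRintegral_cst nu).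
apply: le_bRintegral; [exact: bmeas_cst|exact: bmeas_kernelM|move=> y].
by apply: ler_pM => //; [exact: ltW|case/andP: (k_bnd (x, y))].
Qed.

Lemma kernel_int_le (u : R) b x : 0 <= u -> bmeas b -> (forall y, 0 <= b y <= u) ->
  kernel_int b x <= u.
Proof.
move=> u0 bb ub; rewrite -[X in _ <= X](bRintegral_cst nu).
apply: le_bRintegral; [exact: bmeas_kernelM|exact: bmeas_cst|move=> y].
case/andP: (k_bnd (x, y)) => k1 k2; case/andP: (ub y) => b1 b2.
by rewrite -[leRHS]mul1r ler_pM// (le_trans _ k1)// ltW.
Qed.

Lemma kernel_int_comparable b x x' : bmeas b -> (forall y, 0 <= b y) ->
  kap * kernel_int b x <= kernel_int b x'.
Proof.
move=> bb b0; rewrite /kernel_int -bRintegralZl; last exact: bmeas_kernelM.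
apply: le_bRintegral.
- by apply: bmeasM; [exact: bmeas_cst|exact: bmeas_kernelM].
- exact: bmeas_kernelM.
- move=> y; rewrite mulrA ler_wpM2r//.
  case/andP: (k_bnd (x, y)) => k1 k2; case/andP: (k_bnd (x', y)) => k3 k4.
  by rewrite (le_trans _ k3)// ler_piMr// ltW.
Qed.

(** A kernel bounded between [kap] and 1 contracts the projective distance: the
excess [D - 1] of the oscillation is multiplied by at most [1 - kap ^+ 2].  The
idea is to split [b1] as [a * b2 + e] with [a] the infimum of [b1 / b2], and to
use that all values of the integral of [e] are comparable up to [kap]. *)
Lemma half_step_contraction (l D : R) (b1 b2 : T2 -> R) :
    0 < l -> bmeas b1 -> bmeas b2 ->
    (forall y, l <= b1 y) -> (forall y, l <= b2 y) -> 1 <= D ->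
    ratio_le D b1 b2 ->
  forall x x', kernel_int b1 x' * kernel_int b2 x <=
    (1 + (1 - kap ^+ 2) * (D - 1)) * (kernel_int b1 x * kernel_int b2 x').
Proof.
move=> l0 mb1 mb2 lb1 lb2 D1 rD x x'.
have b10 y : 0 < b1 y by rewrite (lt_le_trans l0).
have b20 y : 0 < b2 y by rewrite (lt_le_trans l0).
have [k1 k1'] := andP (k_bnd (x, point)).
pose h y := b1 y / b2 y.
have h0 y : 0 < h y by rewrite divr_gt0.
pose a := inf (range h).
have hlb : has_lbound (range h) by exists 0 => _ [y _ <-]; exact/ltW.
have ah y : a <= h y by apply: ge_inf => //; exists y.
have a0 : 0 <= a by apply: lb_le_inf; [exists (h point); exists point|move=> _ [y _ <-]; exact/ltW].
have D0 : 0 < D by rewrite (lt_le_trans _ D1).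
have hD y : h y <= D * a.
  rewrite -ler_pdivrMl//; apply: lb_le_inf; first by exists (h point); exists point.
  move=> _ [y' _ <-]; rewrite ler_pdivrMl// /h ler_pdivrMr//.
  rewrite mulrAC mulrA ler_pdivlMr//.
  by rewrite (le_trans (rD y y'))// [b1 y' * _]mulrC mulrA.
have ab y : a * b2 y <= b1 y by rewrite -ler_pdivlMr//; exact: ah.
have bD y : b1 y <= D * a * b2 y by rewrite -ler_pdivrMr//; exact: hD.
pose e y := b1 y - a * b2 y.
have me : bmeas e by apply: bmeasB => //; apply: bmeasM => //; exact: bmeas_cst.
have e0 y : 0 <= e y by rewrite subr_ge0.
have kM z : bmeas (fun y => k (z, y) * (a * b2 y)).
  by apply: bmeas_kernelM; apply: bmeasM => //; exact: bmeas_cst.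
have Ie z : kernel_int e z = kernel_int b1 z - a * kernel_int b2 z.
  rewrite /kernel_int -bRintegralZl; last exact: bmeas_kernelM.
  rewrite -bRintegralB; [|exact: bmeas_kernelM|].
    by apply: eq_Rintegral => y _; rewrite /e; ring.
  by apply: bmeasM; [exact: bmeas_cst|exact: bmeas_kernelM].
have := kernel_int_comparable x' x me e0.
have := kernel_int_comparable x x' mb2 (fun y => ltW (b20 y)).
have := kernel_int_ge x (ltW l0) mb2 lb2.
have := kernel_int_ge x' (ltW l0) mb2 lb2.
have It0 : 0 <= kernel_int e x'.
  by have := kernel_int_ge x' (lexx 0) me e0; rewrite mulr0.
have ItD : kernel_int b1 x' <= D * a * kernel_int b2 x'.
  rewrite /kernel_int -bRintegralZl; last exact: bmeas_kernelM.
  apply: le_bRintegral.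
  - exact: bmeas_kernelM.
  - by apply: bmeasM; [exact: bmeas_cst|exact: bmeas_kernelM].
  - move=> y; rewrite mulrCA ler_wpM2l//.
    by case/andP: (k_bnd (x', y)) => ? _; rewrite (le_trans (ltW kap_gt0)).
move: It0; rewrite !Ie.
set p' := kernel_int b1 x' in ItD *; set p := kernel_int b1 x.
set s' := kernel_int b2 x' in ItD *; set s := kernel_int b2 x.
have kl : 0 < kap * l by rewrite mulr_gt0.
move=> t0 s'0 s0 ss pp.
have {}s'0 : 0 < s' by rewrite (lt_le_trans kl).
have {}s0 : 0 < s by rewrite (lt_le_trans kl).
set t := p' - a * s' in t0 pp.
have pE : a * s * s' + kap ^+ 2 * s * t <= p * s'.
  have H : kap * t * s' <= (p - a * s) * s' by rewrite ler_wpM2r// ltW.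
  have H2 : kap * s * (kap * t) <= s' * (kap * t).
    by rewrite ler_wpM2r// mulr_ge0// ltW.
  by nra.
have tD : t <= (D - 1) * (a * s') by rewrite /t; lra.
have e1 : kap ^+ 2 <= 1.
  by apply: exprn_ile1; [exact/ltW|exact: le_trans k1 k1'].
have D'0 : 0 <= (1 - kap ^+ 2) * (D - 1) by rewrite mulr_ge0// subr_ge0.
rewrite (@le_trans _ _ ((1 + (1 - kap ^+ 2) * (D - 1)) *
   (a * s * s' + kap ^+ 2 * s * t)))//; last by rewrite ler_wpM2l// addr_ge0.
rewrite (_ : p' * s = s * (a * s' + t)); last by rewrite /t; ring.
rewrite (_ : _ * (_ + _ * _) = s * ((1 + (1 - kap ^+ 2) * (D - 1)) *
   (a * s' + kap ^+ 2 * t))); last by ring.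
apply: ler_wpM2l; [exact: ltW|clearbody t].
rewrite mulrDl mul1r mulrDr.
have X1 : (1 - kap ^+ 2) * t <= (1 - kap ^+ 2) * (D - 1) * (a * s').
  by rewrite -mulrA ler_wpM2l// subr_ge0.
have X2 : 0 <= (1 - kap ^+ 2) * (D - 1) * (kap ^+ 2 * t).
  by rewrite mulr_ge0// mulr_ge0// exprn_ge0// ltW.
lra.
Qed.

End half_step.

Lemma geometric_increments_cvg (R : realType) (u : R^nat) (C q : R) :
  0 <= C -> 0 <= q < 1 -> (forall n, `|u n.+1 - u n| <= C * q ^+ n) ->
  cvgn u.
Proof.
move=> C0 /andP[q0 q1] h.
have cs : cvgn (series (telescope u)).
  apply: normed_cvg; apply: (@series_le_cvg _ _ (geometric C q)) => //.
  - by move=> n /=.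
  - by move=> n; rewrite /geometric /= mulr_ge0// exprn_ge0.
  - by apply: is_cvg_geometric_series; rewrite ger0_norm.
rewrite (_ : u = cst (u 0%N) + series (telescope u)).
  by apply: is_cvgD => //; exact: is_cvg_cst.
by apply/funext => n; exact: eq_sum_telescope.
Qed.

(** Dominated convergence for the integral operator. *)
Lemma kernel_int_cvg d1 d2 (T1 : measurableType d1) (T2 : measurableType d2)
    (R : realType) (nu : probability T2 R) (k : T1 * T2 -> R) (kap M : R)
    (b_ : (T2 -> R)^nat) (b : T2 -> R) (x : T1) :
  measurable_fun [set: T1 * T2] k -> (forall z, kap <= k z <= 1) ->
  (forall n, measurable_fun [set: T2] (b_ n)) -> measurable_fun [set: T2] b ->
  (forall n y, 0 <= b_ n y <= M) -> (forall y, 0 <= b y <= M) ->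
  (forall y, b_ n y @[n --> \oo] --> b y) -> 0 <= kap ->
  kernel_int nu k (b_ n) x @[n --> \oo] --> kernel_int nu k b x.
Proof.
move=> mk kb mb_ mb hM hMb bcv kap0.
have M0 : 0 <= M by case/andP: (hMb point) => h; exact: le_trans.
have bk := bmeas_between mk kb.
have bb_ n : bmeas (fun y => k (x, y) * b_ n y).
  by apply: bmeasM; [exact: bmeas_sectionl|exact: (bmeas_between (mb_ n) (hM n))].
have bb : bmeas (fun y => k (x, y) * b y).
  by apply: bmeasM; [exact: bmeas_sectionl|exact: (bmeas_between mb hMb)].
suff /fine_cvg : (\int[nu]_y (k (x, y) * b_ n y)%:E)%E @[n --> \oo] -->
    (kernel_int nu k b x)%:E by [].
rewrite /kernel_int EFin_bRintegral//.
apply: (@dominated_cvg _ _ _ nu [set: T2] measurableT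
  (fun n y => (k (x, y) * b_ n y)%:E) (fun y => (k (x, y) * b y)%:E)
  (fun=> M%:E)).
- by move=> n; apply/measurable_EFinP; case: (bb_ n).
- move=> y _; apply: cvg_EFin; first by near=> n.
  by apply: cvgMr; exact: bcv.
- by [].
- exact: (bmeas_integrable nu (bmeas_cst M)).
- move=> n y _; rewrite abse_EFin lee_fin normrM.
  case/andP: (kb (x, y)) => k1 k2; case/andP: (hM n y) => h1 h2.
  rewrite !ger0_norm//; last exact: le_trans k1.
  by rewrite -[leRHS]mul1r ler_pM// (le_trans kap0).
Unshelve. all: by end_near. Qed.

Lemma ratio_le_inv (R : realFieldType) (K p1 p1' p2 p2' q1 q2 : R) :
  0 < p1 -> 0 < p1' -> 0 < p2 -> 0 < p2' -> 0 <= q1 -> 0 <= q2 ->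
  p1' * p2 <= K * (p1 * p2') ->
  q1 / p1 * (q2 / p2') <= K * (q1 / p1' * (q2 / p2)).
Proof.
move=> h1 h1' h2 h2' g1 g2 H.
rewrite !mulf_div mulrA ler_pdivrMr ?mulr_gt0// mulrAC ler_pdivlMr ?mulr_gt0//.
by rewrite [leRHS]mulrAC [leRHS]mulrC ler_wpM2l// mulr_ge0.
Qed.

Section sinkhorn.
Context {d1 d2 : measure_display} {T1 : measurableType d1}
  {T2 : measurableType d2} {R : realType}.
Variables (mu : probability T1 R) (nu : probability T2 R).
Variables (k : T1 * T2 -> R) (kap : R).
Hypotheses (kap_gt0 : 0 < kap) (mk : measurable_fun [set: T1 * T2] k)
  (k_bnd : forall z, kap <= k z <= 1).

Let kT (z : T2 * T1) : R := k (z.2, z.1).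

Let mkT : measurable_fun [set: T2 * T1] kT.
Proof. by apply: measurableT_comp => //; exact: measurable_swap. Qed.

Let kT_bnd z : kap <= kT z <= 1.
Proof. exact: k_bnd. Qed.

Let I := kernel_int nu k.
Let J := kernel_int mu kT.

Let mkernel_int (b : T2 -> R) : bmeas b -> measurable_fun [set: T1] (I b).
Proof.
move=> bb; have /(bmeas_Rintegral mu nu)[] // : bmeas (fun z => k z * b z.2).
apply: bmeasM.
  exact: bmeas_between mk k_bnd.
by apply: (@bmeas_comp _ _ _ _ _ b snd).
Qed.

Let mkernel_intT (a : T1 -> R) : bmeas a -> measurable_fun [set: T2] (J a).
Proof.
move=> ba; have /(bmeas_Rintegral nu mu)[] // : bmeas (fun z => kT z * a z.2).
apply: bmeasM.
  exact: bmeas_between mkT kT_bnd.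
by apply: (@bmeas_comp _ _ _ _ _ a snd).
Qed.

Let kap_le1 : kap <= 1.
Proof. by case/andP: (k_bnd point) => h1 h2; exact: le_trans h2. Qed.

Let kapV_ge1 : 1 <= kap^-1.
Proof. by rewrite invf_ge1. Qed.

(** The scaling of the first variable that makes the first marginal of
[a x * k (x, y) * b y] right, given [b]. *)
Definition marginal_scaling (b : T2 -> R) (x : T1) : R := (I b x)^-1.

(** One Sinkhorn iteration, seen on the scaling of the second variable and
normalized to be 1 at [point]: the normalization turns the contraction of the
projective distance into pointwise convergence. *)
Definition sinkhorn (b : T2 -> R) (y : T2) : R :=
  J (marginal_scaling b) point / J (marginal_scaling b) y.

(* the iterates stay in this set, on which the contraction is uniform *)
Let good (b : T2 -> R) :=
  measurable_fun [set: T2] b /\ forall y, kap <= b y <= kap^-1.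

Let good_bmeas b : good b -> bmeas b.
Proof. by case=> mb hb; exact: bmeas_between mb hb. Qed.

Let I_bnd b : good b -> forall x, kap ^+ 2 <= I b x <= kap^-1.
Proof.
move=> gb x; have bb := good_bmeas gb; case: gb => _ hb.
apply/andP; split.
  by apply: kernel_int_ge => //; [exact/ltW|move=> y; case/andP: (hb y)].
apply: (kernel_int_le _ kap_gt0 mk k_bnd) => //.
  by rewrite invr_ge0 ltW.
by move=> y; case/andP: (hb y) => h1 h2; rewrite h2 andbT (le_trans _ h1)// ltW.
Qed.

Let I_gt0 b : good b -> forall x, 0 < I b x.
Proof.
by move=> gb x; case/andP: (I_bnd gb x) => h _; rewrite (lt_le_trans _ h)// exprn_gt0.
Qed.

Lemma marginal_scaling_bnd b : good b ->
  forall x, kap <= marginal_scaling b x <= kap ^- 2.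
Proof.
move=> gb x; case/andP: (I_bnd gb x) => h1 h2; have h3 := I_gt0 gb x.
rewrite /marginal_scaling lef_pV2 ?posrE ?exprn_gt0// h1 andbT.
by rewrite -[leLHS]invrK lef_pV2// posrE invr_gt0.
Qed.

Lemma bmeas_marginal_scaling b : good b -> bmeas (marginal_scaling b).
Proof.
move=> gb; apply: (@bmeas_inv _ _ _ _ (kap ^+ 2)); first by rewrite exprn_gt0.
  exact/mkernel_int/good_bmeas.
by move=> x; case/andP: (I_bnd gb x).
Qed.

Let J_gt0 b : good b -> forall y, 0 < J (marginal_scaling b) y.
Proof.
move=> gb y; have k2 : 0 < kap * kap by rewrite mulr_gt0.
rewrite (lt_le_trans k2)//; apply: kernel_int_ge => //; first exact: ltW.
  exact: bmeas_marginal_scaling.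
by move=> x; case/andP: (marginal_scaling_bnd gb x).
Qed.

Let ms_ge0 b : good b -> forall x, 0 <= marginal_scaling b x.
Proof. by move=> gb x; rewrite invr_ge0 ltW// I_gt0. Qed.

Let sinkhorn_good b : good b -> good (sinkhorn b).
Proof.
move=> gb; have bA := bmeas_marginal_scaling gb.
have cmp y y' : kap * J (marginal_scaling b) y <= J (marginal_scaling b) y'.
  by apply: kernel_int_comparable => //; exact: ms_ge0.
have J0 := J_gt0 gb; split.
  have Jp y : kap * J (marginal_scaling b) point <= J (marginal_scaling b) y by [].
  apply: measurable_funM => //; apply: (bmeas_inv _ _ Jp).1.
    by rewrite mulr_gt0.
  exact: mkernel_intT.
move=> y; rewrite /sinkhorn ler_pdivlMr// cmp/= ler_pdivrMr//.
by rewrite mulrC ler_pdivlMr// mulrC cmp.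
Qed.

Let sinkhorn_point b : good b -> sinkhorn b point = 1.
Proof. by move=> gb; rewrite /sinkhorn divff// gt_eqF// J_gt0. Qed.

Let theta := 1 - kap ^+ 2.

Let theta01 : 0 <= theta < 1.
Proof.
have k1 : kap ^+ 2 <= 1 by apply: exprn_ile1 => //; exact: ltW.
by rewrite /theta subr_ge0 k1/= ltrBlDr ltrDl exprn_gt0.
Qed.

Let sinkhorn_contraction (D : R) b1 b2 : 1 <= D -> good b1 -> good b2 ->
  ratio_le D b1 b2 ->
  ratio_le (1 + theta ^+ 2 * (D - 1)) (sinkhorn b1) (sinkhorn b2).
Proof.
move=> D1 g1 g2 r12; case/andP: theta01 => th0 th1.
have D'1 : 1 <= 1 + theta * (D - 1) by rewrite lerDl mulr_ge0// subr_ge0.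
have r : ratio_le (1 + theta * (D - 1)) (marginal_scaling b1) (marginal_scaling b2).
  move=> x x'; have [p1 p1' p2 p2'] :=
    And4 (I_gt0 g1 x) (I_gt0 g1 x') (I_gt0 g2 x) (I_gt0 g2 x').
  rewrite /marginal_scaling; have := @ratio_le_inv _ (1 + theta * (D - 1))
    (I b1 x) (I b1 x') (I b2 x) (I b2 x') 1 1; rewrite !div1r; apply => //.
  apply: (half_step_contraction nu kap_gt0 mk k_bnd kap_gt0) => //.
  - exact: good_bmeas.
  - exact: good_bmeas.
  - by move=> y; case/andP: (g1.2 y).
  - by move=> y; case/andP: (g2.2 y).
move=> y y'; have [p1 p1' p2 p2'] :=
  And4 (J_gt0 g1 y) (J_gt0 g1 y') (J_gt0 g2 y) (J_gt0 g2 y').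
have [q1 q2] := conj (J_gt0 g1 point) (J_gt0 g2 point).
have := half_step_contraction mu kap_gt0 mkT kT_bnd kap_gt0
  (bmeas_marginal_scaling g1) (bmeas_marginal_scaling g2)
  (fun x => (andP (marginal_scaling_bnd g1 x)).1)
  (fun x => (andP (marginal_scaling_bnd g2 x)).1) D'1 r y y'.
rewrite -/J -/theta (_ : 1 + theta * (D - 1) - 1 = theta * (D - 1)); last by ring.
rewrite mulrA -expr2 /sinkhorn => H.
exact: (ratio_le_inv p1 p1' p2 p2' (ltW q1) (ltW q2) H).
Qed.

Let sk n := iter n sinkhorn (fun=> 1).

Let sk_good n : good (sk n).
Proof.
elim: n => [|n IH]; last exact: sinkhorn_good.
by split; [exact: measurable_cst|move=> y; rewrite kap_le1].
Qed.

Let sk_point n : sk n point = 1.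
Proof. by case: n => [//|n]; exact/sinkhorn_point/sk_good. Qed.

Let D0 := kap ^- 2.

Let sk_ratio n : ratio_le (1 + (theta ^+ 2) ^+ n * (D0 - 1)) (sk n.+1) (sk n).
Proof.
have D01 : 1 <= D0 by rewrite /D0 invf_ge1 ?exprn_gt0// exprn_ile1// ltW.
elim: n => [|n IH].
  move=> y y' /=; rewrite expr0 mul1r subrKC !mulr1.
  have gs := sinkhorn_good (sk_good 0).
  have [/andP[h1 h2] /andP[h3 h4]] := (gs.2 y, gs.2 y').
  rewrite (le_trans h2)// /D0 expr2 invfM -[leLHS]mulr1 -mulrA ler_wpM2l//.
    by rewrite invr_ge0 ltW.
  by rewrite ler_pdivlMl// mulr1.
have := sinkhorn_contraction _ (sk_good n.+1) (sk_good n) IH.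
rewrite -/sk (_ : 1 + _ - 1 = (theta ^+ 2) ^+ n * (D0 - 1)); last by ring.
rewrite mulrA -exprS; apply.
by rewrite lerDl mulr_ge0 ?subr_ge0// exprn_ge0// exprn_ge0// (andP theta01).1.
Qed.

Let sk_cvg y : cvgn (sk ^~ y).
Proof.
have D01 : 1 <= D0 by rewrite /D0 invf_ge1 ?exprn_gt0// exprn_ile1// ltW.
case/andP: theta01 => th0 th1.
apply: (@geometric_increments_cvg _ _ (kap^-1 * (D0 - 1)) (theta ^+ 2)).
- by rewrite mulr_ge0 ?subr_ge0// invr_ge0 ltW.
- by rewrite exprn_ge0//= exprn_ilt1.
move=> n; set E := (theta ^+ 2) ^+ n * (D0 - 1).
have E0 : 0 <= E by rewrite mulr_ge0 ?subr_ge0// exprn_ge0// exprn_ge0.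
have r1 := sk_ratio n y point; have r2 := sk_ratio n point y.
rewrite !sk_point -/E !mulr1 !mul1r in r1 r2.
have [/andP[h1 h2] /andP[h3 h4]] := ((sk_good n.+1).2 y, (sk_good n).2 y).
have F : E * kap^-1 = kap^-1 * (D0 - 1) * (theta ^+ 2) ^+ n by rewrite /E; ring.
have e1 : E * sk n y <= E * kap^-1 by rewrite ler_wpM2l.
have e2 : E * sk n.+1 y <= E * kap^-1 by rewrite ler_wpM2l.
by rewrite -F ler_norml; apply/andP; split; lra.
Qed.

(** The limit [b] of the iterates is a fixed point, so the second marginal of
[a x * k (x, y) * b y] is right up to a constant factor; the factor is 1 by
Fubini, because the first marginal has total mass 1. *)
Lemma schrodinger_system : exists (a : T1 -> R) (b : T2 -> R),
  [/\ measurable_fun [set: T1] a, measurable_fun [set: T2] b,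
      (forall x, kap <= a x <= kap ^- 2) & (forall y, kap <= b y <= kap^-1)] /\
  (forall x, \int[nu]_y (a x * k (x, y) * b y) = 1) /\
  (forall y, \int[mu]_x (a x * k (x, y) * b y) = 1).
Proof.
pose b y := limn (sk ^~ y).
have bcv y : sk n y @[n --> \oo] --> b y by exact: sk_cvg.
have gb : good b.
  split; first exact: (measurable_fun_cvg (fun n => (sk_good n).1) (fun y _ => bcv y)).
  move=> y; apply/andP; split.
    by apply: limr_ge => //; near=> n; case/andP: ((sk_good n).2 y).
  by apply: limr_le => //; near=> n; case/andP: ((sk_good n).2 y).
have kV0 y (c : T2 -> R) : good c -> 0 <= c y <= kap^-1.
  by case=> _ /(_ y)/andP[h ->]; rewrite andbT (le_trans _ h)// ltW.
have Icv x : I (sk n) x @[n --> \oo] --> I b x.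
  apply: (@kernel_int_cvg _ _ _ _ _ nu k kap kap^-1) => //.
  - by move=> n; exact: (sk_good n).1.
  - exact: gb.1.
  - by move=> n y; exact/kV0/sk_good.
  - by move=> y; exact: kV0.
  - exact: ltW.
have Acv x : marginal_scaling (sk n) x @[n --> \oo] --> marginal_scaling b x.
  by apply: cvgV => //; rewrite gt_eqF// I_gt0.
have kA x c : good c -> 0 <= marginal_scaling c x <= kap ^- 2.
  by move=> gc; rewrite ms_ge0//=; case/andP: (marginal_scaling_bnd gc x).
have Jcv y : J (marginal_scaling (sk n)) y @[n --> \oo] --> J (marginal_scaling b) y.
  apply: (@kernel_int_cvg _ _ _ _ _ mu kT kap (kap ^- 2)) => //.
  - by move=> n; exact: (bmeas_marginal_scaling (sk_good n)).1.
  - exact: (bmeas_marginal_scaling gb).1.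
  - by move=> n x; exact/kA/sk_good.
  - by move=> x; exact: kA.
  - exact: ltW.
have fixb y : sinkhorn b y = b y.
  have h1 : sinkhorn (sk n) y @[n --> \oo] --> sinkhorn b y.
    by apply: cvgM => //; apply: cvgV => //; rewrite gt_eqF// J_gt0.
  have h2 : sinkhorn (sk n) y @[n --> \oo] --> b y.
    by have := bcv y; rewrite -(cvg_shiftS (sk ^~ y)).
  exact: (cvg_unique _ h1 h2).
have bA := bmeas_marginal_scaling gb.
have bb := good_bmeas gb.
have bk := bmeas_between mk k_bnd.
set a := marginal_scaling b in bA.
have row x : \int[nu]_y (a x * k (x, y) * b y) = 1.
  under eq_Rintegral do rewrite -mulrA.
  rewrite bRintegralZl; last by apply: bmeasM => //; exact: bmeas_sectionl.
  by rewrite -[X in _ * X]/(I b x) /a /marginal_scaling mulVf// gt_eqF// I_gt0.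
have col y : \int[mu]_x (a x * k (x, y) * b y) = J a point.
  rewrite bRintegralZr; last by apply: bmeasM => //; exact: bmeas_sectionr.
  rewrite (_ : Rintegral _ _ _ = J a y); last first.
    by apply: eq_Rintegral => x _; rewrite mulrC.
  by rewrite -fixb /sinkhorn -/a mulrC divfK// gt_eqF// J_gt0.
have J1 : J a point = 1.
  have bq : bmeas (fun z => a z.1 * k z * b z.2).
    apply: bmeasM; first (apply: bmeasM => //).
      exact: (@bmeas_comp _ _ _ _ _ a fst).
    exact: (@bmeas_comp _ _ _ _ _ b snd).
  have := bFubini mu nu bq.
  under eq_Rintegral do rewrite row.
  under [RHS]eq_Rintegral do rewrite col.
  by rewrite !bRintegral_cst.
exists a, b; split; last by split=> // y; rewrite col.
split=> //; [exact: bA.1|exact: gb.1|exact: marginal_scaling_bnd|exact: gb.2].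
Unshelve. all: by end_near. Qed.

End sinkhorn.

(** * Densities and relative entropy *)

Section density_measure.
Context {d : measure_display} {T : measurableType d} {R : realType}.
Variables (rho : probability T R) (q : T -> R).
Hypotheses (mq : measurable_fun [set: T] q) (q0 : forall z, 0 <= q z)
  (q1 : (\int[rho]_z (q z)%:E = 1)%E).

(** The probability measure of density [q] with respect to [rho].  The
conditions on [q] are arguments of the definition, so that the measure and
probability structures below can be found from them. *)
Definition density_measure of (measurable_fun [set: T] q) &
    (forall z, 0 <= q z) & (\int[rho]_z (q z)%:E = 1)%E :=
  fun A => (\int[rho]_(z in A) (q z)%:E)%E.

Local Notation pi := (density_measure mq q0 q1).

Let pi0 : pi set0 = 0%E.
Proof. by rewrite /density_measure integral_set0. Qed.

Let pi_ge0 A : (0 <= pi A)%E.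
Proof. by apply: integral_ge0 => z _; rewrite lee_fin. Qed.

Let pi_sigma_additive : semi_sigma_additive pi.
Proof.
by apply: semi_sigma_additive_nng_induced => //; exact/measurable_EFinP.
Qed.

HB.instance Definition _ := isMeasure.Build _ _ _ pi pi0 pi_ge0
  pi_sigma_additive.

Let piT : pi [set: T] = 1%E. Proof. exact: q1. Qed.

HB.instance Definition _ := Measure_isProbability.Build _ _ _ pi piT.

Lemma density_dominates : pi `<< rho.
Proof.
apply/null_content_dominatesP => A mA rA0; rewrite /= /density_measure.
apply: null_set_integral => //.
exact/measurable_funTS/measurable_EFinP.
Qed.

Lemma density_Radon_Nikodym :
  ae_eq rho [set: T] (Radon_Nikodym (charge_of_finite_measure pi) rho)
    (EFin \o q).
Proof.
apply: integral_ae_eq => //.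
- apply: Radon_Nikodym_integrable; exact: density_dominates.
- exact/measurable_EFinP.
- move=> E _ mE; rewrite -Radon_Nikodym_integral//; exact: density_dominates.
Qed.

Lemma density_integral (f : T -> R) : bmeas f ->
  (\int[pi]_z (f z)%:E = \int[rho]_z (f z * q z)%:E)%E.
Proof.
move=> bf; have numu := density_dominates.
rewrite -(Radon_Nikodym_change_of_variables numu)//; last first.
  exact: (bmeas_integrable pi bf).
apply: ae_eq_integral => //.
- apply: emeasurable_funM; first by apply/measurable_EFinP; exact: bf.1.
  by apply: (measurable_int rho); exact: Radon_Nikodym_integrable.
- by apply/measurable_EFinP; apply: measurable_funM => //; exact: bf.1.
by have := density_Radon_Nikodym; apply: filterS => z /= h /h ->; rewrite EFinM.
Qed.

End density_measure.

Lemma measurable_lne (R : realType) : measurable_fun [set: \bar R] (@lne R).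
Proof.
rewrite (_ : @lne R = fun x => if (x <= 0)%E then -oo%E else
  if x \is a fin_num then (ln (fine x))%:E else x); last first.
  by apply/funext => -[r| |]//=; rewrite ?leNye// lee_fin; case: ifP.
apply: measurable_fun_ifT => //=.
  apply: (measurable_fun_bool true) => /=; rewrite ?setTI.
  rewrite (_ : _ @^-1` _ = [set` Interval -oo%O (BRight 0%E)]).
    exact: emeasurable_itv.
  by apply/seteqP; split=> x /=; rewrite in_itv/=; case: leP.
apply: measurable_fun_ifT => //=.
  by apply: (measurable_fun_bool true); exact/emeasurable_fin_num.
by apply/measurable_EFinP; apply: measurableT_comp.
Qed.

Lemma KL_density d (T : measurableType d) (R : realType) (rho : probability T R)
    (L : T -> R) (mq : measurable_fun [set: T] (fun z => expR (L z)))
    (q0 : forall z, 0 <= expR (L z))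
    (q1 : (\int[rho]_z (expR (L z))%:E = 1)%E) :
  bmeas L ->
  KL (density_measure mq q0 q1) rho =
  (\int[density_measure mq q0 q1]_z L z)%:E.
Proof.
move=> bL; have numu := density_dominates mq q0 q1.
rewrite /KL asboolT// EFin_bRintegral//; apply: ae_eq_integral => //.
- apply: (@measurableT_comp _ _ _ _ _ _ (@lne R)); first exact: measurable_lne.
  by apply: (measurable_int rho); exact: Radon_Nikodym_integrable.
- by apply/measurable_EFinP; exact: bL.1.
have := density_Radon_Nikodym mq q0 q1.
move/(null_dominates_ae_eq measurableT numu).
by apply: filterS => z /= h /h ->; rewrite lne_EFin ?expR_gt0// expRK.
Qed.

(** The uniqueness half of Gibbs' variational principle: if [expR L] is a
probability density with respect to [rho], then the relative entropy of [pi]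
is at least the integral of [L] against [pi], with equality only for the
measure of density [expR L].  With [r] the density of [pi] and
[x = L - ln r], the integral of [expR x - 1 - x] against [pi] is nonpositive,
so that the nonnegative integrand vanishes. *)
Section KL_minimizer.
Context {d : measure_display} {T : measurableType d} {R : realType}.
Variables (rho pi : probability T R) (L : T -> R).
Hypotheses (bL : bmeas L) (L1 : \int[rho]_z expR (L z) = 1)
  (KL_le : (KL pi rho <= (\int[pi]_z L z)%:E)%E).

Let numu : pi `<< rho.
Proof. by move: KL_le; rewrite /KL; case: asboolP. Qed.

Let D := Radon_Nikodym_SigmaFinite.f pi rho.
Let r z := fine (D z).

Let DE z : D z = (r z)%:E.
Proof. by rewrite /r fineK//; exact: Radon_Nikodym_SigmaFinite.f_fin_num. Qed.

Let r0 z : 0 <= r z.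
Proof. by rewrite -lee_fin -DE; exact: Radon_Nikodym_SigmaFinite.f_ge0. Qed.

Let mr : measurable_fun [set: T] r.
Proof.
apply/measurable_EFinP; rewrite (_ : _ \o _ = D); last by apply/funext => z /=; rewrite -DE.
by apply: (measurable_int rho); exact: Radon_Nikodym_SigmaFinite.f_integrable.
Qed.

Let piE A : measurable A -> pi A = (\int[rho]_(z in A) (r z)%:E)%E.
Proof.
move=> mA; rewrite (Radon_Nikodym_SigmaFinite.f_integral numu)//.
by apply: eq_integral => z _; rewrite -/D DE.
Qed.

(* the density is positive almost surely under pi itself *)
Let r_gt0 : {ae pi, forall z, 0 < r z}.
Proof.
exists [set z | r z = 0]; split.
- rewrite -[X in measurable X]setTI; exact: (mr measurableT (measurable_set1 0)).
- rewrite piE; last first.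
    rewrite -[X in measurable X]setTI; exact: (mr measurableT (measurable_set1 0)).
  by rewrite integral0_eq// => z ->.
- by move=> z /= /negP; rewrite -leNgt => h; apply/eqP; rewrite eq_le h r0.
Qed.

Let KLE : KL pi rho = (\int[pi]_z (ln (r z))%:E)%E.
Proof.
rewrite /KL asboolT//; apply: ae_eq_integral => //.
- apply: (@measurableT_comp _ _ _ _ _ _ (@lne R)); first exact: measurable_lne.
  by apply: (measurable_int rho); exact: Radon_Nikodym_integrable.
- by apply/measurable_EFinP; apply: measurableT_comp.
have := null_dominates_ae_eq measurableT numu
  (ae_eq_Radon_Nikodym_SigmaFinite numu measurableT).
by apply: filterS2 r_gt0 => z /= rz h /h <-; rewrite -/D DE lne_EFin.
Qed.

Let x z := L z - ln (r z).

Let mx : measurable_fun [set: T] x.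
Proof. by apply: measurable_funB; [exact: bL.1|exact: measurableT_comp]. Qed.

Let int_expR_x : (\int[pi]_z (expR (x z))%:E <= 1)%E.
Proof.
rewrite -(Radon_Nikodym_SigmaFinite.change_of_variables numu)//; last first.
  by apply/measurable_EFinP; exact: measurableT_comp.
rewrite -L1 EFin_bRintegral; last exact: bmeas_expR.
apply: ge0_le_integral => //.
- by move=> z _; rewrite -/D DE lee_fin mulr_ge0// expR_ge0.
- apply: emeasurable_funM; first by apply/measurable_EFinP; exact: measurableT_comp.
  by apply: (measurable_int rho); exact: Radon_Nikodym_SigmaFinite.f_integrable.
- by apply/measurable_EFinP; exact: (bmeas_expR bL).1.
move=> z _; rewrite -/D DE lee_fin; move: (r0 z); rewrite le_eqVlt => /predU1P[<-|rz].
  by rewrite mulr0 expR_ge0.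
by rewrite /x expRB lnK// divfK// gt_eqF.
Qed.

Let ig_expR : pi.-integrable [set: T] (EFin \o (fun z => expR (x z))).
Proof.
apply/integrableP; split; first by apply/measurable_EFinP; exact: measurableT_comp.
rewrite (le_lt_trans _ (ltry 1))//= (le_trans _ int_expR_x)//.
by under eq_integral do rewrite ger0_norm ?expR_ge0//.
Qed.

Let ig_L : pi.-integrable [set: T] (EFin \o L).
Proof. exact: bmeas_integrable. Qed.

(* the negative part of ln r is dominated by expR x + |L|; the positive part is
   integrable because the relative entropy is finite *)
Let ig_ln : pi.-integrable [set: T] (EFin \o (fun z => ln (r z))).
Proof.
have mln : measurable_fun [set: T] (EFin \o (fun z => ln (r z))).
  by apply/measurable_EFinP; exact: measurableT_comp.
have neg_fin : (\int[pi]_z ((EFin \o (fun z => ln (r z)))^\- z) < +oo)%E.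
  have ig : pi.-integrable [set: T]
      (fun z => (expR (x z))%:E + `|(EFin \o L) z|)%E.
    by apply: integrableD => //; exact: integrable_abse.
  have /integrableP[mg /(le_lt_trans _)] := ig; apply.
  apply: ge0_le_integral => //.
  - exact: measurable_funeneg.
  - exact: measurableT_comp.
  move=> z _; rewrite funenegE/= ge_max; apply/andP; split.
    rewrite lee_fin (le_trans _ (ler_norm _))//.
    have := expR_ge1Dx (x z); have := ler_norm (- L z); rewrite normrN /x.
    lra.
  by rewrite lee_fin.
have : (\int[pi]_z (ln (r z))%:E < +oo)%E.
  by rewrite -KLE (le_lt_trans KL_le)// ltry.
rewrite integralE => pos_fin.
have neg0 : (0 <= \int[pi]_z ((EFin \o (fun z => ln (r z)))^\- z))%E.
  by apply: integral_ge0 => z _; exact: funeneg_ge0.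
have Nfin : (\int[pi]_z ((EFin \o (fun z => ln (r z)))^\- z))%E \is a fin_num.
  by rewrite ge0_fin_numE.
have P_fin : (\int[pi]_z ((EFin \o (fun z => ln (r z)))^\+ z) < +oo)%E.
  by move: pos_fin; rewrite lteBlDr// => /lt_le_trans; apply; rewrite leey.
apply/integrableP; split => //.
under eq_integral do rewrite -[(`|_|)%E]/((abse \o (EFin \o (fun z => ln (r z)))) _).
rewrite fune_abse.
rewrite ge0_integralD//; first exact: lte_add_pinfty.
- exact: measurable_funepos.
- exact: measurable_funeneg.
Qed.

Let h z := expR (x z) - 1 - x z.

Let h0 z : 0 <= h z.
Proof. by rewrite /h; have := expR_ge1Dx (x z); lra. Qed.

Let ae_x0 : {ae pi, forall z, r z = expR (L z)}.
Proof.
have igB f g : pi.-integrable [set: T] (EFin \o f) ->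
    pi.-integrable [set: T] (EFin \o g) ->
    pi.-integrable [set: T] (EFin \o (fun z => f z - g z)).
  move=> igf igg; have := integrableB measurableT igf igg.
  by congr (_.-integrable _ _); apply/funext => z /=; rewrite EFinB.
have int1 : pi.-integrable [set: T] (EFin \o (fun=> 1)).
  exact: bmeas_integrable (bmeas_cst 1).
have ig1 := igB _ _ ig_expR int1.
have ig2 := igB _ _ ig1 (igB _ _ ig_L ig_ln).
have KL' := KL_le; rewrite KLE -[X in (X <= _)%E]fineK in KL'; last first.
  exact: (integrable_fin_num measurableT ig_ln).
rewrite lee_fin in KL'.
have ex1 : \int[pi]_z expR (x z) <= 1.
  rewrite -lee_fin (le_trans _ int_expR_x)// fineK//.
  exact: (integrable_fin_num measurableT ig_expR).
have hE : \int[pi]_z h z <= 0.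
  rewrite (_ : h = fun z => expR (x z) - 1 - (L z - ln (r z))); last first.
    by apply/funext => z; rewrite /h /x.
  rewrite RintegralB//; last exact: igB.
  rewrite RintegralB// RintegralB// bRintegral_cst.
  move: ex1 KL'; rewrite /Rintegral; lra.
have mh : measurable_fun [set: T] (EFin \o h).
  by apply: (measurable_int pi); rewrite (_ : h = fun z => expR (x z) - 1 - (L z - ln (r z))).
have /ae_eq_integral_abs /= : (\int[pi]_z `|(EFin \o h) z|)%E = 0%E.
  under eq_integral do rewrite /= ger0_norm//.
  apply/eqP; rewrite eq_le; apply/andP; split.
    rewrite -[leLHS]fineK//.
    rewrite (_ : h = fun z => expR (x z) - 1 - (L z - ln (r z)))//.
    exact: (integrable_fin_num measurableT ig2).
  by apply: integral_ge0 => z _; rewrite lee_fin.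
move=> /(_ measurableT mh); apply: filterS2 r_gt0 => z rz /(_ I) [].
rewrite /h => hz; have [x0|/expR_gt1Dx] := eqVneq (x z) 0; last lra.
by rewrite -[LHS]lnK//; congr expR; move: x0; rewrite /x; lra.
Qed.

(** The equality of densities holds [pi]-almost surely first.  The set where it
fails is [pi]-null, so [expR L] has mass 1 outside it, hence mass 0 on it, and
it is [rho]-null because [expR L] is bounded below. *)
Lemma KL_le_density : {ae rho, forall z,
  fine (Radon_Nikodym (charge_of_finite_measure pi) rho z) = expR (L z)}.
Proof.
pose N := [set z | r z != expR (L z)].
have mN : measurable N.
  rewrite (_ : N = ~` ((fun z => r z - expR (L z)) @^-1` [set 0])).
    apply: measurableC; rewrite -[X in measurable X]setTI.
    apply: (measurable_funB mr _ measurableT (measurable_set1 0)).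
    exact: (bmeas_expR bL).1.
  apply/seteqP; split => z /=.
    by move=> /eqP + /eqP; rewrite subr_eq0 => h1 /eqP.
  by move=> h1; apply/eqP => h2; apply: h1; rewrite h2 subrr.
have piN : pi N = 0%E.
  by case: ae_x0 => B [mB B0 sub]; apply: (subset_measure0 mN mB _ B0) => z /eqP /sub.
have piCN : pi (~` N) = 1%E by rewrite probability_setC// piN sube0.
have bq := bmeas_expR bL.
have mq : measurable_fun [set: T] (fun z => (expR (L z))%:E).
  by apply/measurable_EFinP; exact: bq.1.
have q1 : (\int[rho]_z (expR (L z))%:E = 1)%E by rewrite -EFin_bRintegral// L1.
have qCN : (\int[rho]_(z in ~` N) (expR (L z))%:E = 1)%E.
  rewrite -piCN piE; last exact: measurableC.
  by apply: eq_integral => z /set_mem /= /negP; rewrite negbK => /eqP ->.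
have qN : (\int[rho]_(z in N) (expR (L z))%:E = 0)%E.
  have := q1; rewrite -(setUv N) ge0_integral_setU//.
  - rewrite qCN; case: (\int[rho]_(z in N) _)%E => [t| |]//= [] t1.
    by congr EFin; move: t1; lra.
  - exact: measurableC.
  - by rewrite setUv.
  - by apply/disj_setPS; rewrite setICr.
have rhoN : rho N = 0%E.
  have [_ [M LM]] := bL.
  have : ((expR (- M))%:E * rho N <= 0)%E.
    rewrite -integral_cst// -qN; apply: ge0_le_integral => //.
    - by move=> z _; rewrite lee_fin expR_ge0.
    - exact: measurable_funTS.
    - move=> z _; rewrite lee_fin ler_expR.
      by have := LM z; rewrite ler_norml => /andP[].
  rewrite pmule_rle0 ?lte_fin ?expR_gt0// => h1.
  by apply/eqP; rewrite eq_le h1 measure_ge0.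
have : {ae rho, forall z, r z = expR (L z)}.
  by exists N; split => // z /= /eqP.
apply: filterS2 (ae_eq_Radon_Nikodym_SigmaFinite numu measurableT).
by move=> z /(_ I) <- <-.
Qed.

End KL_minimizer.

(** * The density of the Schrodinger coupling *)

(** The potentials solve the Schrodinger system at every point, not only almost
everywhere, and their bounds do not depend on [eta]. *)
Lemma schrodinger_potentials d1 d2 (T1 : measurableType d1)
    (T2 : measurableType d2) (R : realType) (mu : probability T1 R)
    (nu : probability T2 R) (eta : R) (c : T1 * T2 -> R) :
  0 < eta -> measurable_fun [set: T1 * T2] c -> (forall z, 0 <= c z <= 1) ->
  exists (f : T1 -> R) (g : T2 -> R),
  [/\ measurable_fun [set: T1] f, measurable_fun [set: T2] g,
      (forall x, -1 <= f x <= 2) & (forall y, -1 <= g y <= 1)] /\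
  (forall x, \int[nu]_y expR (- eta * (c (x, y) - f x - g y)) = 1) /\
  (forall y, \int[mu]_x expR (- eta * (c (x, y) - f x - g y)) = 1).
Proof.
move=> eta0 mc c01.
have mk : measurable_fun [set: T1 * T2] (fun z => expR (- eta * c z)).
  by apply: measurableT_comp => //; exact: measurable_funM.
have kb z : expR (- eta) <= expR (- eta * c z) <= 1.
  by case/andP: (c01 z) => h1 h2; rewrite -[X in _ <= _ <= X]expR0 !ler_expR; nra.
have [a [b [[ma mb ha hb] [row col]]]] :=
  schrodinger_system mu nu (expR_gt0 (- eta)) mk kb.
have a0 x : 0 < a x by case/andP: (ha x) => h _; rewrite (lt_le_trans (expR_gt0 _) h).
have b0 y : 0 < b y by case/andP: (hb y) => h _; rewrite (lt_le_trans (expR_gt0 _) h).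
have qE x y : expR (- eta * (c (x, y) - eta^-1 * ln (a x) - eta^-1 * ln (b y))) =
    a x * expR (- eta * c (x, y)) * b y.
  rewrite -[in RHS](lnK (a0 x)) -[in RHS](lnK (b0 y)) -!expRD; congr expR.
  by field; rewrite gt_eqF.
exists (fun x => eta^-1 * ln (a x)), (fun y => eta^-1 * ln (b y)); split; last first.
  split=> [x|y].
    by rewrite -(row x); apply: eq_Rintegral => y _; rewrite qE.
  by rewrite -(col y); apply: eq_Rintegral => x _; rewrite qE.
have logb (t u v : R) : 0 < t -> expR u <= t <= expR v -> u <= ln t <= v.
  by move=> t0 /andP[h1 h2]; rewrite -ler_expR lnK// h1/= -ler_expR lnK.
split.
- by apply: measurable_funM => //; exact: measurableT_comp.
- by apply: measurable_funM => //; exact: measurableT_comp.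
- move=> x; have /logb : expR (- eta) <= a x <= expR (2 * eta).
    case/andP: (ha x) => -> /=.
    by rewrite expRN exprVn invrK -expRM_natl mulr_natl.
  by move=> /(_ (a0 x))/andP[h1 h2]; rewrite !ler_pdivlMl// ler_pdivrMl//; lra.
- move=> y; have /logb : expR (- eta) <= b y <= expR eta.
    by case/andP: (hb y) => -> /=; rewrite expRN invrK.
  by move=> /(_ (b0 y))/andP[h1 h2]; rewrite !ler_pdivlMl// ler_pdivrMl//; lra.
Qed.

Section euclidean_cost.
Context {R : realType} {d : nat}.
Notation V := (d.-tuple R).

Lemma enorm_sqr (x : V) : enorm x ^+ 2 = \sum_(i < d) tnth x i ^+ 2.
Proof. by rewrite sqr_sqrtr// sumr_ge0// => i _; exact: sqr_ge0. Qed.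

Lemma sqdistE (x y : V) : sqdist x y = \sum_(i < d) (tnth x i - tnth y i) ^+ 2.
Proof. by rewrite /sqdist enorm_sqr; apply: eq_bigr => i _; rewrite tnth_mktuple. Qed.

Lemma sqdist_ge0 (x y : V) : 0 <= sqdist x y.
Proof. exact: sqr_ge0. Qed.

Lemma sqdist_le1 (x y : V) : enorm x <= 2^-1 -> enorm y <= 2^-1 -> sqdist x y <= 1.
Proof.
have sq (z : V) : enorm z <= 2^-1 -> \sum_(i < d) tnth z i ^+ 2 <= 2^-1 ^+ 2.
  by move=> h; rewrite -enorm_sqr lerXn2r// nnegrE ?sqrtr_ge0.
move=> /sq hx /sq hy; rewrite sqdistE.
apply: (@le_trans _ _ (2 * (\sum_(i < d) tnth x i ^+ 2) + 2 * (\sum_(i < d) tnth y i ^+ 2))).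
  rewrite !mulr_sumr -big_split; apply: ler_sum => i _ /=.
  by have := sqr_ge0 (tnth x i + tnth y i); lra.
by lra.
Qed.

Lemma measurable_sqdist :
  measurable_fun [set: V * V] (fun z => sqdist z.1 z.2).
Proof.
under eq_fun do rewrite sqdistE.
apply: measurable_sum => i; apply: measurable_funX.
by apply: measurable_funB; apply: (@measurableT_comp _ _ _ _ _ _ (fun x : V => tnth x i)) => //;
  exact: measurable_tnth.
Qed.

(** The squared distance capped at 1: it agrees with the squared distance on the
ball of radius 1/2, hence almost surely, and is bounded everywhere. *)
Definition capped_cost (z : V * V) : R := Num.min (sqdist z.1 z.2) 1.

Lemma measurable_capped_cost : measurable_fun [set: V * V] capped_cost.
Proof. by apply: measurable_minr => //; exact: measurable_sqdist. Qed.

Lemma capped_cost01 z : 0 <= capped_cost z <= 1.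
Proof. by rewrite /capped_cost le_min sqdist_ge0 ler01 ge_min lexx orbT. Qed.

Lemma capped_costE x y : enorm x <= 2^-1 -> enorm y <= 2^-1 ->
  capped_cost (x, y) = sqdist x y.
Proof. by move=> hx hy; apply/min_idPl; exact: sqdist_le1. Qed.

End euclidean_cost.

Section coupling.
Context {R : realType} {d : nat}.
Notation V := (d.-tuple R).
Variables (mu nu : probability V R) (pi : probability (V * V)%type R).
Hypothesis pi_cpl : coupling mu nu pi.

Lemma coupling_integral_fst (f : V -> R) : bmeas f ->
  \int[pi]_z f z.1 = \int[mu]_x f x.
Proof.
move=> bf; have bf1 : bmeas (f \o fst : V * V -> R) by exact: bmeas_comp.
apply: EFin_inj; rewrite !EFin_bRintegral//.
have -> : (\int[mu]_x (f x)%:E = \int[pushforward pi fst]_x (f x)%:E)%E.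
  apply: eq_measure_integral => A mA _.
  apply: (etrans (esym (pi_cpl mA).1)); congr (pi _).
  by apply/seteqP; split => -[x y] //= [].
rewrite integral_pushforward//.
- by apply/measurable_EFinP; exact: bf.1.
- exact: (bmeas_integrable pi bf1).
Qed.

Lemma coupling_integral_snd (g : V -> R) : bmeas g ->
  \int[pi]_z g z.2 = \int[nu]_y g y.
Proof.
move=> bg; have bg2 : bmeas (g \o snd : V * V -> R) by exact: bmeas_comp.
apply: EFin_inj; rewrite !EFin_bRintegral//.
have -> : (\int[nu]_x (g x)%:E = \int[pushforward pi snd]_x (g x)%:E)%E.
  apply: eq_measure_integral => A mA _.
  apply: (etrans (esym (pi_cpl mA).2)); congr (pi _).
  by apply/seteqP; split => -[x y] //= [].
rewrite integral_pushforward//.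
- by apply/measurable_EFinP; exact: bg.1.
- exact: (bmeas_integrable pi bg2).
Qed.

Lemma coupling_ae (P Q : V -> Prop) :
  {ae mu, forall x, P x} -> {ae nu, forall y, Q y} ->
  {ae pi, forall z, P z.1 /\ Q z.2}.
Proof.
move=> [A [mA A0 PA]] [B [mB B0 QB]].
have h1 : {ae pi, forall z, P z.1}.
  exists (A `*` setT); split; first exact: measurableX.
    exact: etrans (pi_cpl mA).1 A0.
  by move=> z /= h; split => //; exact: PA.
have h2 : {ae pi, forall z, Q z.2}.
  exists (setT `*` B); split; first exact: measurableX.
    exact: etrans (pi_cpl mB).2 B0.
  by move=> z /= h; split => //; exact: QB.
by apply: filterS2 h1 h2.
Qed.

End coupling.

Section schrodinger_density.
Context {R : realType} {d : nat}.
Notation V := (d.-tuple R).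
Variables (mu nu : probability V R) (eta : R) (f g : V -> R).
Hypotheses (eta_gt0 : 0 < eta)
  (mu_supp : {ae mu, forall x, enorm x <= 2^-1})
  (nu_supp : {ae nu, forall y, enorm y <= 2^-1})
  (bf : bmeas f) (bg : bmeas g).

Let L (z : V * V) : R := - eta * (capped_cost z - f z.1 - g z.2).

Hypotheses (row : forall x, \int[nu]_y expR (L (x, y)) = 1)
  (col : forall y, \int[mu]_x expR (L (x, y)) = 1).

Let bcost : bmeas (@capped_cost R d).
Proof. exact: bmeas_between measurable_capped_cost capped_cost01. Qed.

Let bf1 : bmeas (fun z : V * V => f z.1).
Proof. exact: (@bmeas_comp _ _ _ _ _ f fst). Qed.

Let bg2 : bmeas (fun z : V * V => g z.2).
Proof. exact: (@bmeas_comp _ _ _ _ _ g snd). Qed.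

Let bL : bmeas L.
Proof.
apply: bmeasM; first exact: bmeas_cst.
by apply: bmeasB => //; exact: bmeasB.
Qed.

(** With [expR L] the candidate density, the transport cost of a coupling
depends on the coupling only through the integral of [L]. *)
Lemma coupling_cost (pi : probability (V * V)%type R) : coupling mu nu pi ->
  (\int[pi]_z (sqdist z.1 z.2)%:E =
  (\int[mu]_x f x + \int[nu]_y g y - eta^-1 * \int[pi]_z L z)%:E)%E.
Proof.
move=> cpl.
have -> : (\int[pi]_z (sqdist z.1 z.2)%:E = \int[pi]_z (capped_cost z)%:E)%E.
  apply: ae_eq_integral => //.
  - by apply/measurable_EFinP; exact: measurable_sqdist.
  - by apply/measurable_EFinP; exact: measurable_capped_cost.
  apply: filterS (coupling_ae cpl mu_supp nu_supp) => -[x y] /= [hx hy] _.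
  by rewrite capped_costE.
rewrite -EFin_bRintegral//; congr EFin.
rewrite -(coupling_integral_fst cpl bf) -(coupling_integral_snd cpl bg).
rewrite -bRintegralD// -bRintegralZl// -bRintegralB//.
- apply: eq_Rintegral => z _; rewrite /L; field.
  by rewrite gt_eqF.
- exact: bmeasD.
- by apply: bmeasM => //; exact: bmeas_cst.
Qed.

Let rho : probability (V * V)%type R := (mu \x nu)%E.

Let q1 : (\int[rho]_z (expR (L z))%:E = 1)%E.
Proof.
have bq := bmeas_expR bL.
rewrite /rho fubini_tonelli1; last 2 first.
- by apply/measurable_EFinP; exact: bq.1.
- by move=> z; rewrite lee_fin expR_ge0.
transitivity (\int[mu]_x (1%R)%:E)%E.
  apply: eq_integral => x _; rewrite /fubini_F -EFin_bRintegral ?row//.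
  exact: (bmeas_sectionl x bq).
by rewrite -EFin_bRintegral ?bRintegral_cst//; exact: bmeas_cst.
Qed.

Let mq := (bmeas_expR bL).1.
Let q0 z : 0 <= expR (L z) := expR_ge0 _.
Let pi' := density_measure mq q0 q1.

Let pi'_coupling : coupling mu nu (density_measure mq q0 q1).
Proof.
have bI d' (T : measurableType d') (A : set T) : measurable A -> bmeas (\1_A : T -> R).
  move=> mA; split; first exact: measurable_indic.
  by exists 1 => x; rewrite indicE; case: (_ \in _); rewrite /= ?normr1 ?normr0.
have bq := bmeas_expR bL.
have piE (h : V * V -> R) : bmeas h ->
    (\int[pi']_z (h z)%:E = (\int[mu]_x \int[nu]_y (h (x, y) * expR (L (x, y))))%:E)%E.
  move=> bh; have bhq : bmeas (fun z => h z * expR (L z)) by exact: bmeasM.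
  rewrite density_integral// EFin_bRintegral; last exact: (bmeas_Rintegral mu nu bhq).
  rewrite -(integral12_prod_meas1 (bmeas_integrable rho bhq)).
  apply: eq_integral => x _.
  by rewrite EFin_bRintegral//; exact: (bmeas_sectionl x bhq).
have piI (B : set (V * V)) : measurable B -> pi' B = (\int[pi']_z (\1_B z)%:E)%E.
  by move=> mB; rewrite integral_indic// setIT.
move=> A mA; split.
- have mA' : measurable (A `*` [set: V]) by exact: measurableX.
  rewrite -[LHS]/(pi' _) piI// piE; last exact: bI.
  transitivity (\int[mu]_x (\1_A x)%:E)%E; last by rewrite integral_indic// setIT.
  rewrite -EFin_bRintegral; last exact: bI.
  congr EFin; apply: eq_Rintegral => x _.
  rewrite -[RHS]mulr1 -(row x) -bRintegralZl; last exact: (bmeas_sectionl x bq).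
  apply: eq_Rintegral => y _; rewrite !indicE; congr ((nat_of_bool _)%:R * _).
  by apply/idP/idP; rewrite !inE /=; [case|move=> ?; split].
- have mA' : measurable ([set: V] `*` A) by exact: measurableX.
  have b1 := bI _ _ _ mA'.
  rewrite -[LHS]/(pi' _) piI// piE//.
  rewrite (bFubini mu nu (k := fun z => \1_([set: V] `*` A) z * expR (L z))); last exact: bmeasM.
  transitivity (\int[nu]_x (\1_A x)%:E)%E; last by rewrite integral_indic// setIT.
  rewrite -EFin_bRintegral; last exact: bI.
  congr EFin; apply: eq_Rintegral => y _.
  rewrite -[RHS]mulr1 -(col y) -bRintegralZl; last exact: (bmeas_sectionr y bq).
  apply: eq_Rintegral => x _; rewrite !indicE; congr ((nat_of_bool _)%:R * _).
  by apply/idP/idP; rewrite !inE /=; [case|move=> ?; split].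
Qed.

Lemma schrodinger_densityE (pi : probability (V * V)%type R) :
  schrodinger_coupling eta mu nu pi ->
  {ae (mu \x nu)%E, forall z, schrodinger_density mu nu pi z = expR (L z)}.
Proof.
move=> [cpl opt]; apply: (@KL_le_density _ _ _ rho pi L bL).
  by apply: EFin_inj; rewrite EFin_bRintegral ?q1//; exact: bmeas_expR.
have := opt _ pi'_coupling; rewrite /eot_cost.
rewrite (coupling_cost cpl) (coupling_cost pi'_coupling).
have -> : KL (density_measure mq q0 q1) (mu \x nu)%E =
    (\int[density_measure mq q0 q1]_z L z)%:E by exact: KL_density.
rewrite -EFinM -EFinD subrK.
rewrite -[KL pi (mu \x nu)%E]/(KL pi rho).
case: (KL pi rho) => [k| |] //.
  rewrite -EFinM -EFinD !lee_fin -addrA gerDl addrC -mulrBr.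
  by rewrite pmulr_rle0 ?invr_gt0// subr_le0.
  by rewrite gt0_muley ?lte_fin ?invr_gt0.
by rewrite leNye.
Qed.

End schrodinger_density.

(** * Independence and conditioning on the past *)

Section independence.
Context {dO dT : measure_display} {Omega : measurableType dO}
  {T : measurableType dT} {R : realType} {P : probability Omega R}.
Context {I : finType}.
Variable Z : I -> {RV P >-> T}.
Hypothesis indep : mutually_independent Z.

(** The events described by finitely many coordinatewise conditions on the
variables [Z i], [i] in [J]; they form a pi-system generating the sigma-algebra
of these variables. *)
Definition cylinders (J : {set I}) : set (set Omega) :=
  [set C | exists2 A : I -> set T, (forall i, measurable (A i)) &
    C = [set w | forall i, i \in J -> A i (Z i w)]].

Lemma cylinders_measurable J : cylinders J `<=` measurable.
Proof.
move=> _ [A mA ->].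
rewrite (_ : [set w | _] = \big[setI/setT]_(i in J) (Z i @^-1` A i)).
  apply: bigsetI_measurable => i _; exact: measurable_funPTI.
apply/seteqP; split=> w /=.
  by move=> h; rewrite -bigcap_seq_cond => i /= /andP[_ /h].
by rewrite -bigcap_seq_cond => h i iJ; apply: h; rewrite /= mem_index_enum.
Qed.

Lemma setI_closed_cylinders J : setI_closed (cylinders J).
Proof.
move=> _ _ [A mA ->] [B mB ->]; exists (fun i => A i `&` B i).
  by move=> i; exact: measurableI.
apply/seteqP; split=> w /=.
  by move=> [h1 h2] i iJ; split; [exact: h1|exact: h2].
by move=> h; split=> i /h [].
Qed.

Lemma cylinders_setT J : cylinders J setT.
Proof. by exists (fun=> setT) => //; apply/seteqP; split. Qed.

Lemma sigma_cylinders_measurable J : <<s cylinders J >> `<=` measurable.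
Proof.
apply: smallest_sub; first exact: sigma_algebra_measurable.
exact: cylinders_measurable.
Qed.

Lemma cylinder_Z (J : {set I}) i (A : set T) : i \in J -> measurable A -> cylinders J (Z i @^-1` A).
Proof.
move=> iJ mA; exists (fun j => if j == i then A else setT).
  by move=> j; case: ifP.
apply/seteqP; split=> w /=.
  by move=> h j jJ; case: eqP => [->|].
by move=> /(_ i iJ); rewrite eqxx.
Qed.

Lemma independent_cylinders (J : {set I}) k (C : set Omega) (B : set T) : k \notin J ->
  <<s cylinders J >> C -> measurable B ->
  P (C `&` Z k @^-1` B) = (P C * P (Z k @^-1` B))%E.
Proof.
move=> kJ sC mB.
have mZB : measurable (Z k @^-1` B).
  exact: measurable_funPTI.
have p0 : 0 <= fine (P (Z k @^-1` B)) by exact: fine_ge0.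
have pE : P (Z k @^-1` B) = (fine (P (Z k @^-1` B)))%:E by rewrite fineK// fin_num_measure.
pose m2 := mscale (NngNum p0) P.
have -> : (P C * P (Z k @^-1` B) = m2 C)%E by rewrite /m2/= /mscale/= muleC {1}pE.
rewrite -[LHS]/(mrestr P mZB C).
apply: (g_sigma_algebra_measure_unique (cylinders J) _ (fun=> setT)) => //.
- exact: cylinders_measurable.
- by move=> _; exact: cylinders_setT.
- by rewrite bigcup_const.
- exact: setI_closed_cylinders.
- move=> _ [A mA ->].
  rewrite /m2/= /mscale/= -pE /mrestr.
  pose A' i := if i == k then B else A i.
  have mA' i : measurable (A' i) by rewrite /A'; case: ifP.
  have A'J i : i \in J -> A' i = A i.
    by move=> iJ; rewrite /A'; case: eqP => // ik; rewrite -ik iJ in kJ.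
  have := indep (k |: J) mA'; rewrite big_setU1//= {2}/A' eqxx.
  rewrite (eq_bigr (fun i => P (Z i @^-1` A i))); last by move=> i /A'J ->.
  rewrite -(indep J mA) => <-; congr (P _).
  apply/seteqP; split=> w /=.
    move=> [h1 h2] i; rewrite in_setU1 => /predU1P[->|iJ]; first by rewrite /A' eqxx.
    by rewrite A'J//; exact: h1.
  move=> h; split.
    by move=> i iJ; rewrite -A'J//; apply: h; rewrite in_setU1 iJ orbT.
  by have := h k (setU11 _ _); rewrite /A' eqxx.
- by move=> _; rewrite (le_lt_trans (probability_le1 _ _)) ?ltry// setTI.
Qed.

(** The sample space with the sigma-algebra generated by [Z i], [i] in [J]. *)
Definition past (J : {set I}) := g_sigma_algebraType (cylinders J).

Lemma measurable_past_Z (J : {set I}) i : i \in J ->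
  measurable_fun [set: past J] (fun w : past J => Z i (w : Omega)).
Proof.
move=> iJ _ B mB; rewrite setTI; apply: sub_sigma_algebra.
exact: cylinder_Z.
Qed.

Lemma measurable_to_past (J : {set I}) :
  measurable_fun [set: Omega] (fun w : Omega => w : past J).
Proof.
move=> _ B mB; rewrite setTI; exact: (sigma_cylinders_measurable (J := J)).
Qed.

(** Conditioning on the past: a variable outside [J] can be integrated out under
its law while the variables in [J] are held fixed. *)
Lemma integral_past (J : {set I}) k (nu : probability T R)
    (G : past J * T -> \bar R) :
  k \notin J -> has_law (Z k) nu -> measurable_fun [set: past J * T] G ->
  (forall z, 0 <= G z)%E ->
  (\int[P]_w G (w : past J, Z k w) = \int[P]_w \int[nu]_y G (w : past J, y))%E.
Proof.
move=> kJ lawk mG G0.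
have mid := @measurable_to_past J.
pose idJ : {RV P >-> past J} := HB.pack (fun w : Omega => w : past J)
  (isMeasurableFun.Build _ _ _ _ _ mid).
have mpair : measurable_fun [set: Omega] (fun w : Omega => (w : past J, Z k w)).
  by apply/measurable_fun_pairP; split.
have mF : measurable_fun [set: past J] (fun w => \int[nu]_y G (w, y))%E.
  exact: (measurable_fun_fubini_tonelli_F (m2 := nu) G mG G0).
transitivity (\int[pushforward P (fun w : Omega => (w : past J, Z k w))]_z G z)%E.
  by rewrite ge0_integral_pushforward.
transitivity (\int[(distribution P idJ \x nu)%E]_z G z)%E; last first.
  rewrite fubini_tonelli1//.
  rewrite ge0_integral_pushforward// => w _; exact: integral_ge0.
apply: eq_measure_integral => A mA _; apply/esym.
apply: product_measure_unique => // {mA}A B mA mB.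
apply: (@etrans _ _ (P A * P (Z k @^-1` B))%E).
  exact: (independent_cylinders kJ mA mB).
by congr (_ * _)%E; exact: lawk.
Qed.

Lemma measurable_past_sub (J J' : {set I}) : J \subset J' ->
  measurable_fun [set: past J'] (fun w : past J' => w : past J).
Proof.
move=> /fintype.subsetP JJ' _ B mB; rewrite setTI /=.
suff : <<s cylinders J >> `<=` <<s cylinders J' >> by apply.
apply: smallest_sub; first exact: smallest_sigma_algebra.
move=> _ [A mA ->]; apply: sub_sigma_algebra.
exists (fun i => if i \in J then A i else setT); first by move=> i; case: ifP.
apply/seteqP; split=> w /= h i.
  by move=> _; case: ifP => // /h.
by move=> iJ; have := h i (JJ' _ iJ); rewrite iJ.
Qed.

End independence.

Lemma pair_law dO dT (Omega : measurableType dO) (T : measurableType dT)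
    (R : realType) (P : probability Omega R) (I : finType)
    (Z : I -> {RV P >-> T}) (mu nu : probability T R) (i k : I)
    (N : set (T * T)) : mutually_independent Z -> i != k ->
  has_law (Z i) mu -> has_law (Z k) nu -> measurable N ->
  P [set w | N (Z i w, Z k w)] = (mu \x nu)%E N.
Proof.
move=> indep ik lawi lawk mN.
have mpair : measurable_fun [set: Omega] (fun w => (Z i w, Z k w)).
  by apply/measurable_fun_pairP; split.
rewrite -[LHS]/(pushforward P (fun w => (Z i w, Z k w)) N).
apply/esym; apply: product_measure_unique => // {mN} A B mA mB.
pose J : {set I} := finset.set1 i.
have kS : k \notin J by rewrite finset.in_set1 eq_sym.
have cA : <<s cylinders Z J >> (Z i @^-1` A).
  by apply: sub_sigma_algebra; apply: cylinder_Z => //; rewrite finset.in_set1.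
apply: (etrans (independent_cylinders indep kS cA mB)).
by congr (_ * _)%E; [exact: lawi|exact: lawk].
Qed.

(** * Mean square deviations of empirical means *)

Lemma expR_le_sqr (R : realType) (x : R) : expR x <= x + expR (2 * x ^+ 2).
Proof.
have H (y : R) : expR y * (1 - y) <= 1.
  have := expR_ge1Dx (- y); have := expR_gt0 y => e0 h.
  have : expR y * (1 + - y) <= expR y * expR (- y) by rewrite ler_wpM2l// ltW.
  by rewrite -expRD subrr expR0.
have := expR_ge1Dx (2 * x ^+ 2) => h2.
have [x1|x1] := lerP x 1; last first.
  rewrite (@le_trans _ _ (expR (2 * x ^+ 2)))//; last by lra.
  by rewrite ler_expR; nra.
suff h : expR x <= 1 + x + 2 * x ^+ 2 by lra.
have [x0|x0] := lerP x 0.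
  have hx := H x.
  have pos : 0 < 1 - x by lra.
  rewrite -(ler_pM2r pos) (le_trans hx)//.
  have : 0 <= x ^+ 2 * (1 - 2 * x) by rewrite mulr_ge0// ?sqr_ge0//; lra.
  by rewrite !exprS expr0; lra.
have hx := H (x / 2).
have pos : 0 < (1 - x / 2) ^+ 2 by rewrite exprn_gt0//; lra.
rewrite -(ler_pM2r pos).
have -> : expR x = expR (x / 2) ^+ 2 by rewrite expr2 -expRD; congr expR; lra.
rewrite -exprMn (@le_trans _ _ 1)//.
  rewrite expr_le1//; apply: mulr_ge0; first exact: expR_ge0.
  by lra.
have : 0 <= x ^+ 2 * ((1 - x) * (5 / 4 - x / 2)).
  by rewrite mulr_ge0 ?sqr_ge0// mulr_ge0//; lra.
by rewrite !exprS expr0; lra.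
Qed.

(** A bounded centered variable is subgaussian. *)
Lemma expR_centered_le d (T : measurableType d) (R : realType)
    (nu : probability T R) (h : T -> R) (M : R) :
  bmeas h -> (forall y, h y ^+ 2 <= M) -> \int[nu]_y h y = 0 ->
  \int[nu]_y expR (h y) <= expR (2 * M).
Proof.
move=> bh hM h0; apply: (@le_trans _ _ (\int[nu]_y (h y + expR (2 * M)))).
  apply: le_bRintegral; first exact: bmeas_expR.
    by apply: bmeasD => //; exact: bmeas_cst.
  move=> y; rewrite (le_trans (expR_le_sqr _))// lerD2l ler_expR.
  by rewrite ler_wpM2l.
by rewrite bRintegralD ?bmeas_cst// ?h0 ?bRintegral_cst ?add0r//; exact: bmeas_cst.
Qed.

(** Exponential moment of a completely degenerate quadratic form in the
independent variables [Z (s k)], [k < n].  The kernel [K] may depend on the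
variables [Z i], [i] in [J0], which are independent of the others; [K_CS] is
the Cauchy-Schwarz inequality for the positive semidefinite form [K], the
diagonal being bounded by [B]. *)
Section exponential_moment.
Context {dO dT : measure_display} {Omega : measurableType dO}
  {T : measurableType dT} {R : realType} {P : probability Omega R}.
Context {I : finType}.
Variables (Z : I -> {RV P >-> T}) (indep : mutually_independent Z).
Variables (J0 : {set I}) (n : nat) (s : nat -> I) (nu : probability T R).
Hypotheses (s_J0 : forall k, (k < n)%N -> s k \notin J0)
  (s_inj : forall j k, (j < k < n)%N -> s j != s k)
  (s_law : forall k, (k < n)%N -> has_law (Z (s k)) nu).
Variables (K : Omega -> T -> T -> R) (B : R).
Hypotheses (n_gt0 : (0 < n)%N) (B_gt0 : 0 < B)
  (mK : measurable_fun [set: past Z J0 * (T * T)]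
     (fun z : past Z J0 * (T * T) => K z.1 z.2.1 z.2.2))
  (K_bnd : forall w y y', `|K w y y'| <= B)
  (K_sym : forall w y y', K w y y' = K w y' y)
  (K_center : forall w y', \int[nu]_y K w y' y = 0)
  (K_pos : forall w k (u : 'I_k -> T),
     0 <= \sum_(i < k) \sum_(j < k) K w (u i) (u j))
  (K_CS : forall w k (u : 'I_k -> T) y,
     (\sum_(i < k) K w (u i) y) ^+ 2 <=
     B * \sum_(i < k) \sum_(j < k) K w (u i) (u j)).

Let Jk k := J0 :|: [set s j | j : 'I_k].

(* the quadratic form in the first k variables *)
Let Q k w : R := \sum_(i < k) \sum_(j < k) K w (Z (s i) w) (Z (s j) w).

(* The exponent decreases from 2 / (32 n B) to 1 / (32 n B) in n steps: the
   loss lam k - lam k.+1 pays for the second order term 8 (lam k.+1)^2 B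
   produced when the variable of index k is integrated out. *)
Let lam k : R := (2 - k%:R / n%:R) / (32 * n%:R * B).

Let n0 : 0 < n%:R :> R. Proof. by rewrite ltr0n. Qed.

Let s_Jk k : (k < n)%N -> s k \notin Jk k.
Proof.
move=> kn; rewrite finset.in_setU negb_or s_J0//=; apply/negP => /imsetP[j _ e].
by have /eqP := @s_inj j k (introT andP (conj (ltn_ord j) kn)); rewrite e.
Qed.

Let bK : bmeas (fun z : past Z J0 * (T * T) => K z.1 z.2.1 z.2.2).
Proof. by split => //; exists B => z; exact: K_bnd. Qed.

Let past_id k : measurable_fun [set: past Z (Jk k)]
  (fun w : past Z (Jk k) => w : past Z J0).
Proof. by apply: measurable_past_sub; exact: finset.subsetUl. Qed.

Let past_Zs k (i : 'I_k) : measurable_fun [set: past Z (Jk k)]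
  (fun w : past Z (Jk k) => Z (s i) (w : Omega)).
Proof. by apply: measurable_past_Z; rewrite finset.in_setU imset_f ?orbT. Qed.

Let past_id_fst k : measurable_fun [set: past Z (Jk k) * T]
  (fun z : past Z (Jk k) * T => z.1 : past Z J0).
Proof.
by apply: (@measurableT_comp _ _ _ _ _ _ (fun w : past Z (Jk k) => w : past Z J0) _ fst).
Qed.

Let past_Zs_fst k (i : 'I_k) : measurable_fun [set: past Z (Jk k) * T]
  (fun z : past Z (Jk k) * T => Z (s i) (z.1 : Omega)).
Proof.
by apply: (@measurableT_comp _ _ _ _ _ _ (fun w : past Z (Jk k) => Z (s i) (w : Omega)) _ fst).
Qed.

Let bKij k (i j : 'I_k) :
  bmeas (fun z : past Z (Jk k) * T => K z.1 (Z (s i) z.1) (Z (s j) z.1)).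
Proof.
apply: (@bmeas_comp _ _ _ _ _ _ (fun z : past Z (Jk k) * T =>
  (z.1 : past Z J0, (Z (s i) (z.1 : Omega), Z (s j) (z.1 : Omega))))) bK _.
apply/measurable_fun_pairP; split.
  exact: past_id_fst.
apply/measurable_fun_pairP; split.
  exact: past_Zs_fst.
exact: past_Zs_fst.
Qed.

Let bKi k (i : 'I_k) :
  bmeas (fun z : past Z (Jk k) * T => K z.1 (Z (s i) z.1) z.2).
Proof.
apply: (@bmeas_comp _ _ _ _ _ _ (fun z : past Z (Jk k) * T =>
  (z.1 : past Z J0, (Z (s i) (z.1 : Omega), z.2)))) bK _.
apply/measurable_fun_pairP; split.
  exact: past_id_fst.
apply/measurable_fun_pairP; split; first exact: past_Zs_fst.
exact: measurable_snd.
Qed.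

Let bKd k : bmeas (fun z : past Z (Jk k) * T => K z.1 z.2 z.2).
Proof.
apply: (@bmeas_comp _ _ _ _ _ _ (fun z : past Z (Jk k) * T =>
  (z.1 : past Z J0, (z.2, z.2)))) bK _.
apply/measurable_fun_pairP; split.
  exact: past_id_fst.
by apply/measurable_fun_pairP; split; exact: measurable_snd.
Qed.

Let QS k w : Q k.+1 w = Q k w +
  2 * (\sum_(i < k) K w (Z (s i) w) (Z (s k) w)) + K w (Z (s k) w) (Z (s k) w).
Proof.
rewrite /Q big_ord_recr/= [X in _ + X]big_ord_recr/= addrA; congr (_ + _).
under eq_bigr do rewrite big_ord_recr/=.
rewrite big_split/= -addrA; congr (_ + _).
rewrite mulr2n mulrDl mul1r; congr (_ + _).
by apply: eq_bigr => i _; rewrite K_sym.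
Qed.

(* Q k.+1 with the variable of index k replaced by a free argument *)
Let G k (z : past Z (Jk k) * T) : R := expR (lam k.+1 *
  (Q k z.1 + 2 * (\sum_(i < k) K z.1 (Z (s i) z.1) z.2) + K z.1 z.2 z.2)).

Let bG k : bmeas (@G k).
Proof.
apply: bmeas_expR; apply: bmeasM; first exact: bmeas_cst.
apply: bmeasD => //; apply: bmeasD.
  by do 2 (apply: bmeas_sum => ?).
by apply: bmeasM; [exact: bmeas_cst|exact: bmeas_sum].
Qed.

Let lam_bnd k : (k < n)%N ->
  [/\ 0 <= lam k.+1, lam k.+1 * B <= (16 * n%:R)^-1 &
      lam k.+1 + 8 * lam k.+1 ^+ 2 * B <= lam k].
Proof.
move=> kn.
have kn1 : k.+1%:R / n%:R <= 1 :> R by rewrite ler_pdivrMr// mul1r ler_nat.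
have kn0 : 0 <= k.+1%:R / n%:R :> R by rewrite divr_ge0.
have den : 0 < 32 * n%:R * B by rewrite !mulr_gt0.
have lE : lam k = lam k.+1 + (32 * n%:R ^+ 2 * B)^-1.
  rewrite /lam -natr1; field.
  by rewrite !gt_eqF.
have l0 : 0 <= lam k.+1 by rewrite divr_ge0 ?ltW//; lra.
have lB : lam k.+1 * B <= (16 * n%:R)^-1.
  have -> : lam k.+1 * B = (2 - k.+1%:R / n%:R) * (32 * n%:R)^-1.
    by rewrite /lam; field; rewrite !gt_eqF.
  have -> : (16 * n%:R)^-1 = 2 * (32 * n%:R)^-1 :> R by field; rewrite !gt_eqF.
  by apply: ler_wpM2r; [rewrite invr_ge0 mulr_ge0//|lra].
split => //; rewrite lE lerD2l.
have -> : 8 * lam k.+1 ^+ 2 * B = 8 * (lam k.+1 * B) ^+ 2 / B.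
  by field; rewrite gt_eqF.
have -> : (32 * n%:R ^+ 2 * B)^-1 = 8 * ((16 * n%:R)^-1) ^+ 2 / B.
  by field; rewrite !gt_eqF.
apply: ler_wpM2r; first by rewrite invr_ge0 ltW.
rewrite ler_wpM2l// lerXn2r// ?nnegrE.
  by rewrite mulr_ge0// ltW.
by rewrite invr_ge0 mulr_ge0 ?ltW.
Qed.

(* The linear part of the exponent is centered, with square at most B * Q k by
   K_CS, so it costs the factor exp(8 (lam k.+1)^2 B (Q k)); the diagonal term
   costs exp(1 / (16 n)). *)
Let G_int k w : (k < n)%N -> \int[nu]_y G (w : past Z (Jk k), y) <=
  expR (lam k * Q k w + (16 * n%:R)^-1).
Proof.
move=> kn; have [l0 lB lE] := lam_bnd kn.
set S := fun y => \sum_(i < k) K w (Z (s i) w) y.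
have bS : bmeas S.
  apply: bmeas_sum => i; exact: (bmeas_sectionl (w : past Z (Jk k)) (bKi i)).
pose C := lam k.+1 * Q k w + (16 * n%:R)^-1.
have Q0 : 0 <= Q k w by exact: K_pos.
have bh : bmeas (fun y => 2 * lam k.+1 * S y) by apply: bmeasM => //; exact: bmeas_cst.
apply: (@le_trans _ _ (expR C * \int[nu]_y expR (2 * lam k.+1 * S y))).
  rewrite -bRintegralZl; last exact: bmeas_expR.
  apply: le_bRintegral.
  - exact: (bmeas_sectionl (w : past Z (Jk k)) (bG k)).
  - by apply: bmeasM; [exact: bmeas_cst|exact: bmeas_expR].
  move=> y; rewrite /G/= -expRD ler_expR /C -/(S y).
  have : lam k.+1 * K w y y <= (16 * n%:R)^-1.
    rewrite (le_trans _ lB)// ler_wpM2l// (le_trans (ler_norm _))//.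
  by lra.
apply: (@le_trans _ _ (expR C * expR (2 * ((2 * lam k.+1) ^+ 2 * (B * Q k w))))).
  rewrite ler_wpM2l ?expR_ge0//; apply: expR_centered_le => //.
    move=> y; rewrite exprMn ler_wpM2l ?sqr_ge0//; exact: K_CS.
  rewrite bRintegralZl// bRintegral_sum; last first.
    by move=> i; exact: (bmeas_sectionl (w : past Z (Jk k)) (bKi i)).
  by rewrite big1 ?mulr0// => i _; exact: K_center.
rewrite -expRD ler_expR /C.
have := ler_wpM2r Q0 lE; rewrite !mulrDl; lra.
Qed.

Let mQ k : measurable_fun [set: Omega] (Q k).
Proof.
have bQ : bmeas (fun w : past Z (Jk k) => Q k w).
  do 2 (apply: bmeas_sum => ?); exact: (bmeas_sectionr point (bKij _ _)).
exact: (measurableT_comp bQ.1 (@measurable_to_past _ _ _ _ _ _ _ Z (Jk k))).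
Qed.

(* by induction, integrating out the last variable conditionally on the past *)
Let moment k : (k <= n)%N ->
  (\int[P]_w (expR (lam k * Q k w))%:E <= (expR (k%:R * (16 * n%:R)^-1))%:E)%E.
Proof.
elim: k => [|k IH] kn.
  rewrite mul0r expR0.
  rewrite (eq_integral (fun=> 1%:E)); last first.
    by move=> w _; rewrite /Q big_ord0 mulr0 expR0.
  by rewrite integral_cst// mul1e; exact: probability_le1.
have mGE : measurable_fun [set: past Z (Jk k) * T] (fun z => (G z)%:E).
  by apply/measurable_EFinP; exact: (bG k).1.
have -> : (\int[P]_w (expR (lam k.+1 * Q k.+1 w))%:E =
    \int[P]_w (G (w : past Z (Jk k), Z (s k) w))%:E)%E.
  by apply: eq_integral => w _; rewrite /G /= QS.
rewrite (integral_past indep (s_Jk kn) (s_law kn) mGE); last first.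
  by move=> z; rewrite lee_fin expR_ge0.
apply: (@le_trans _ _ (\int[P]_w (expR (16 * n%:R)^-1 * expR (lam k * Q k w))%:E)%E).
  apply: ge0_le_integral => //.
  - by move=> w _; apply: integral_ge0 => y _; rewrite lee_fin expR_ge0.
  - have mF : measurable_fun [set: past Z (Jk k)] (fun w => \int[nu]_y (G (w, y))%:E)%E.
      apply: (measurable_fun_fubini_tonelli_F (m2 := nu) _ mGE).
      by move=> z; rewrite lee_fin expR_ge0.
    exact: (measurableT_comp mF (@measurable_to_past _ _ _ _ _ _ _ Z (Jk k))).
  - apply/measurable_EFinP; apply: measurable_funM => //.
    apply: measurableT_comp => //; exact: measurable_funM.
  - move=> w _; rewrite -EFin_bRintegral; last first.
      exact: (bmeas_sectionl (w : past Z (Jk k)) (bG k)).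
    by rewrite lee_fin -expRD addrC; exact: G_int.
under eq_integral do rewrite EFinM.
rewrite ge0_integralZl//; last first.
  by apply/measurable_EFinP; apply: measurableT_comp => //; exact: measurable_funM.
have -> : k.+1%:R / (16 * n%:R) = (16 * n%:R)^-1 + k%:R / (16 * n%:R) :> R.
  by rewrite -natr1 mulrDl mul1r addrC.
rewrite expRD EFinM lee_wpmul2l ?lee_fin ?expR_ge0//.
exact: IH (ltnW kn).
Qed.

Lemma exponential_moment :
  (\int[P]_w (expR ((32 * n%:R * B)^-1 *
     \sum_(i < n) \sum_(j < n) K w (Z (s i) w) (Z (s j) w)))%:E <= 2%:E)%E.
Proof.
have := moment (leqnn n).
rewrite (_ : lam n = (32 * n%:R * B)^-1); last first.
  by rewrite /lam divff ?gt_eqF// (_ : 2 - 1 = 1) ?div1r//; lra.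
move=> /le_trans; apply; rewrite lee_fin.
rewrite (_ : n%:R / _ = 16^-1); last by field; rewrite gt_eqF.
have := expR_ge1Dx (- 16^-1 : R); have := expR_gt0 (16^-1 : R).
have : expR (16^-1 : R) * expR (- 16^-1) = 1 by rewrite -expRD subrr expR0.
by move=> h1 h2 h3; nra.
Qed.

Lemma exponential_moment_measurable :
  measurable_fun [set: Omega] (fun w =>
     \sum_(i < n) \sum_(j < n) K w (Z (s i) w) (Z (s j) w)).
Proof. exact: mQ. Qed.

End exponential_moment.

Section mean_functional.
Context {d : measure_display} {T : measurableType d} {R : realType}.

(** A positive normalized linear functional on bounded measurable functions;
this covers averages over a sample and integrals against a law. *)
Definition mean_functional (A : (T -> R) -> R) :=
  [/\ forall f g, bmeas f -> bmeas g -> A (fun x => f x + g x) = A f + A g,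
      forall r f, bmeas f -> A (fun x => r * f x) = r * A f,
      forall f, bmeas f -> (forall x, 0 <= f x) -> 0 <= A f &
      A (fun=> 1) = 1].

Variables (A : (T -> R) -> R) (meanA : mean_functional A).

Lemma meanB f g : bmeas f -> bmeas g -> A (fun x => f x - g x) = A f - A g.
Proof.
case: meanA => AD AZ _ _ bf bg; rewrite -mulN1r -AZ//.
rewrite -AD//; last by apply: bmeasM => //; exact: bmeas_cst.
by congr A; apply/funext => x; rewrite mulN1r.
Qed.

Lemma mean_le f g : bmeas f -> bmeas g -> (forall x, f x <= g x) -> A f <= A g.
Proof.
case: (meanA) => _ _ Age0 _ bf bg fg; rewrite -subr_ge0 -meanB//.
by apply: Age0; [exact: bmeasB|move=> x; rewrite subr_ge0].
Qed.

Lemma mean_cst r : A (fun=> r) = r.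
Proof.
case: meanA => _ AZ _ A1; rewrite -[RHS]mulr1 -A1 -AZ//; last exact: bmeas_cst.
by congr A; apply/funext => x; rewrite mulr1.
Qed.

Lemma mean_sum (I : Type) (s : seq I) (F : I -> T -> R) :
  (forall i, bmeas (F i)) ->
  A (fun x => \sum_(i <- s) F i x) = \sum_(i <- s) A (F i).
Proof.
case: (meanA) => AD _ _ _ bF; elim: s => [|i s IH].
  by rewrite big_nil -[RHS](mean_cst 0); congr A; apply/funext => x; rewrite big_nil.
rewrite big_cons -IH -AD//; last exact: bmeas_sum.
by congr A; apply/funext => x; rewrite big_cons.
Qed.

Lemma mean_norm_le f b : bmeas f -> (forall x, `|f x| <= b) -> `|A f| <= b.
Proof.
move=> bf fb; rewrite ler_norml -[X in _ <= _ <= X](mean_cst b).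
rewrite -[X in X <= _ <= _](mean_cst (- b)).
by apply/andP; split; apply: mean_le => //; try exact: bmeas_cst;
  move=> x; have := fb x; rewrite ler_norml => /andP[].
Qed.

Lemma mean_Cauchy_Schwarz S f B : 0 < B -> bmeas S -> bmeas f ->
  (forall x, f x ^+ 2 <= B) ->
  A (fun x => S x * f x) ^+ 2 <= B * A (fun x => S x ^+ 2).
Proof.
move=> B0 bS bf fB; case: (meanA) => AD AZ Age0 _.
set a := A (fun x => S x * f x).
have bSf : bmeas (fun x => S x * f x) by exact: bmeasM.
have bS2 := bmeasX 2 bS; have bf2 := bmeasX 2 bf.
have bZ r g : bmeas g -> bmeas (fun x => r * g x).
  by move=> bg; apply: bmeasM => //; exact: bmeas_cst.
have f2B : A (fun x => f x ^+ 2) <= B.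
  rewrite -[X in _ <= X](mean_cst B); apply: mean_le => //; exact: bmeas_cst.
have : 0 <= A (fun x => B ^+ 2 * S x ^+ 2 + a ^+ 2 * f x ^+ 2
    - 2 * B * a * (S x * f x)).
  apply: Age0.
    by apply: bmeasB; [apply: bmeasD; exact: bZ|exact: bZ].
  move=> x; rewrite (_ : _ - _ = (B * S x - a * f x) ^+ 2) ?sqr_ge0//.
  by ring.
rewrite meanB; [|by apply: bmeasD; exact: bZ|exact: bZ].
rewrite AD; [|exact: bZ|exact: bZ].
rewrite !AZ// -/a => h.
have h2 : a ^+ 2 * A (fun x => f x ^+ 2) <= a ^+ 2 * B by rewrite ler_wpM2l ?sqr_ge0.
rewrite -(ler_pM2l B0).
move: h h2; rewrite !exprS !expr0; lra.
Qed.

End mean_functional.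

Lemma Rintegral_mean d (T : measurableType d) (R : realType)
  (mu : probability T R) : mean_functional (fun f => \int[mu]_x f x).
Proof.
split.
- by move=> f g bf bg; exact: bRintegralD.
- by move=> r f bf; exact: bRintegralZl.
- by move=> f bf f0; exact: Rintegral_ge0.
- exact: bRintegral_cst.
Qed.

Lemma average_mean d (T : measurableType d) (R : realType) n (u : 'I_n -> T) :
  (0 < n)%N -> @mean_functional d T R (fun f => n%:R^-1 * \sum_(i < n) f (u i)).
Proof.
move=> n0; split.
- by move=> f g _ _; rewrite big_split mulrDr.
- by move=> r f _; rewrite -mulr_sumr mulrCA.
- by move=> f _ f0; rewrite mulr_ge0 ?invr_ge0// sumr_ge0.
- by rewrite sumr_const card_ord mulVf// pnatr_eq0 -lt0n.
Qed.

Section deviation.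
Context {dO dT : measure_display} {Omega : measurableType dO}
  {T : measurableType dT} {R : realType} {P : probability Omega R}.
Context {I : finType}.
Variables (Z : I -> {RV P >-> T}) (indep : mutually_independent Z).
Variables (J0 : {set I}) (n : nat) (s : nat -> I) (nu : probability T R).
Hypotheses (s_J0 : forall k, (k < n)%N -> s k \notin J0)
  (s_inj : forall j k, (j < k < n)%N -> s j != s k)
  (s_law : forall k, (k < n)%N -> has_law (Z (s k)) nu).
Variables (z : T * T -> R) (b : R) (A : Omega -> (T -> R) -> R).

(** The mean, under [A w] and in the first argument of [z], of the square of the
average of [z] over a sample put in the second argument. *)
Definition mean_square_deviation (w : Omega) : R :=
  A w (fun x => (n%:R^-1 * \sum_(j < n) z (x, Z (s j) w)) ^+ 2).

Hypotheses (n_gt0 : (0 < n)%N) (b_gt0 : 0 < b)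
  (mz : measurable_fun [set: T * T] z) (z_bnd : forall x, `|z x| <= b)
  (meanA : forall w, mean_functional (A w))
  (mK : measurable_fun [set: past Z J0 * (T * T)]
     (fun u : past Z J0 * (T * T) => A u.1 (fun x => z (x, u.2.1) * z (x, u.2.2))))
  (K_center : forall w y',
     \int[nu]_y A w (fun x => z (x, y') * z (x, y)) = 0).

Let bz : bmeas z. Proof. by split => //; exists b. Qed.

Let n0 : 0 < n%:R :> R. Proof. by rewrite ltr0n. Qed.

Let K w y y' := A w (fun x => z (x, y) * z (x, y')).

Let bzz y y' : bmeas (fun x => z (x, y) * z (x, y')).
Proof. by apply: bmeasM; exact: bmeas_sectionr. Qed.

Let KQ w k (u : 'I_k -> T) : \sum_(i < k) \sum_(j < k) K w (u i) (u j) =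
  A w (fun x => (\sum_(i < k) z (x, u i)) ^+ 2).
Proof.
rewrite (_ : (fun x => (\sum_(i < k) z (x, u i)) ^+ 2) =
    fun x => \sum_(i < k) \sum_(j < k) z (x, u i) * z (x, u j)).
  rewrite mean_sum//; last by move=> i; exact: bmeas_sum.
  by apply: eq_bigr => i _; rewrite mean_sum.
apply/funext => x; rewrite expr2 mulr_suml.
by apply: eq_bigr => i _; rewrite mulr_sumr.
Qed.

Let bS k (u : 'I_k -> T) : bmeas (fun x => \sum_(i < k) z (x, u i)).
Proof. by apply: bmeas_sum => i; exact: bmeas_sectionr. Qed.

(* Expanding the square shows a quadratic form in the sample, with kernel
   K w y y' = A w (fun x => z (x, y) * z (x, y')). *)
Let Umean w : mean_square_deviation w = n%:R ^- 2 *
  \sum_(i < n) \sum_(j < n) K w (Z (s i) w) (Z (s j) w).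
Proof.
rewrite KQ /mean_square_deviation; case: (meanA w) => _ AZ _ _.
rewrite -AZ; last exact: bmeasX.
by congr (A w); apply/funext => x; rewrite exprMn exprVn.
Qed.

Let B := b ^+ 2.

Let B0 : 0 < B. Proof. by rewrite exprn_gt0. Qed.

Let K_bnd w y y' : `|K w y y'| <= B.
Proof.
by apply: mean_norm_le => // x; rewrite normrM /B expr2 ler_pM.
Qed.

Let K_sym w y y' : K w y y' = K w y' y.
Proof. by congr (A w); apply/funext => x; rewrite mulrC. Qed.

Let K_pos w k (u : 'I_k -> T) :
  0 <= \sum_(i < k) \sum_(j < k) K w (u i) (u j).
Proof.
rewrite KQ; case: (meanA w) => _ _ Age0 _; apply: Age0; first exact: bmeasX.
by move=> x; exact: sqr_ge0.
Qed.

Let K_CS w k (u : 'I_k -> T) y : (\sum_(i < k) K w (u i) y) ^+ 2 <=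
  B * \sum_(i < k) \sum_(j < k) K w (u i) (u j).
Proof.
rewrite KQ -mean_sum//.
rewrite (_ : (fun x => \sum_(i < k) z (x, u i) * z (x, y)) =
   fun x => (\sum_(i < k) z (x, u i)) * z (x, y)); last first.
  by apply/funext => x; rewrite mulr_suml.
apply: mean_Cauchy_Schwarz => //; first exact: bmeas_sectionr.
move=> x; rewrite /B -(ger0_norm (sqr_ge0 (z (x, y)))) normrX.
by apply: lerXn2r => //; rewrite nnegrE ltW.
Qed.

Lemma deviation_ge0 w : 0 <= mean_square_deviation w.
Proof. by rewrite Umean mulr_ge0 ?invr_ge0 ?exprn_ge0. Qed.

Lemma measurable_deviation : measurable_fun [set: Omega] mean_square_deviation.
Proof.
rewrite (_ : mean_square_deviation = fun w => n%:R ^- 2 *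
  \sum_(i < n) \sum_(j < n) K w (Z (s i) w) (Z (s j) w)); last first.
  by apply/funext => w; exact: Umean.
apply: measurable_funM => //.
exact: (exponential_moment_measurable _ _ mK K_bnd).
Qed.

Let rate : R := n%:R / (32 * b ^+ 2).

Let rate_gt0 : 0 < rate. Proof. by rewrite divr_gt0// mulr_gt0. Qed.

Lemma deviation_exponential_moment :
  (\int[P]_w (expR (rate * mean_square_deviation w))%:E <= 2%:E)%E.
Proof.
apply: le_trans (exponential_moment indep s_J0 s_inj s_law n_gt0 B0 mK K_bnd
  K_sym K_center K_pos K_CS).
rewrite le_eqVlt; apply/orP; left; apply/eqP; apply: eq_integral => w _.
congr (expR _)%:E; rewrite Umean mulrA; congr (_ * _).
by rewrite /rate /B; field; rewrite !gt_eqF.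
Qed.

Lemma deviation_expectation :
  (\int[P]_w (mean_square_deviation w)%:E <= (64 * b ^+ 2 / n%:R)%:E)%E.
Proof.
have mU := measurable_deviation.
have -> : 64 * b ^+ 2 / n%:R = rate^-1 * 2.
  by rewrite /rate; field; rewrite !gt_eqF.
rewrite EFinM; apply: le_trans; last first.
  apply: lee_wpmul2l deviation_exponential_moment.
  by rewrite lee_fin invr_ge0 ltW.
rewrite -ge0_integralZl//; last 2 first.
- by apply/measurable_EFinP; apply: measurableT_comp => //; exact: measurable_funM.
- by rewrite lee_fin invr_ge0 ltW.
apply: ge0_le_integral => //.
- by move=> w _; rewrite lee_fin deviation_ge0.
- exact/measurable_EFinP.
- apply/measurable_EFinP; apply: measurable_funM => //.
  by apply: measurableT_comp => //; exact: measurable_funM.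
move=> w _; rewrite lee_fin ler_pdivlMl//.
by rewrite (le_trans _ (expR_ge1Dx _))// lerDr.
Qed.

Lemma deviation_tail (t : R) :
  (P [set w | (32 * b ^+ 2 * t / n%:R < mean_square_deviation w)%R] <=
   (2 * expR (- t))%:E)%E.
Proof.
have mU := measurable_deviation.
set D := [set w | _].
have mD : measurable D.
  rewrite (_ : D = mean_square_deviation @^-1` [set` `]32 * b ^+ 2 * t / n%:R, +oo[ ]).
    by rewrite -[X in measurable X]setTI; exact: mU.
  by apply/seteqP; split=> w /=; rewrite in_itv/= andbT.
have : ((expR t)%:E * P D <= 2%:E)%E.
  apply: le_trans deviation_exponential_moment.
  rewrite -integral_cst//.
  apply: (@le_trans _ _ (\int[P]_(w in D) (expR (rate * mean_square_deviation w))%:E)%E); last first.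
    apply: ge0_subset_integral => //.
    apply/measurable_EFinP; apply: measurableT_comp => //; exact: measurable_funM.
  apply: ge0_le_integral => //.
  - by move=> w _; rewrite lee_fin expR_ge0.
  - apply/measurable_EFinP/measurable_funTS; apply: measurableT_comp => //.
    exact: measurable_funM.
  move=> w Dw; rewrite lee_fin ler_expR -ler_pdivrMl//.
  rewrite (le_trans _ (ltW Dw))//.
  by rewrite /rate le_eqVlt; apply/orP; left; apply/eqP; field; rewrite !gt_eqF.
rewrite -(@fineK _ (P D)) ?fin_num_measure// -EFinM !lee_fin => h.
by rewrite expRN ler_pdivlMr ?expR_gt0// mulrC.
Qed.

End deviation.

Section two_deviations.
Context {dO dT : measure_display} {Omega : measurableType dO}
  {T : measurableType dT} {R : realType} {P : probability Omega R}.
Context {I : finType}.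
Variables (Z : I -> {RV P >-> T}) (n : nat) (t : nat -> I).
Variables (mu nu : probability T R) (z : T * T -> R) (b : R).
Hypotheses (n_gt0 : (0 < n)%N) (mz : measurable_fun [set: T * T] z)
  (z_bnd : forall x, `|z x| <= b) (z_center : forall x, \int[nu]_y z (x, y) = 0).

Let J0 := [set t j | j : 'I_n].

Let bz : bmeas z. Proof. by split => //; exists b. Qed.

(** The two functionals [A] of interest: the average over the other sample,
and the integral against its law.  The outcome is a dummy argument of the
latter. *)
Definition sample_mean (w : Omega) (f : T -> R) : R :=
  n%:R^-1 * \sum_(i < n) f (Z (t i) w).

Definition population_mean (w : Omega) (f : T -> R) : R := \int[mu]_x f x.

Lemma sample_mean_mean w : mean_functional (sample_mean w).
Proof. exact: (@average_mean _ _ _ _ (fun i : 'I_n => Z (t i) w)). Qed.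

Lemma population_mean_mean w : mean_functional (population_mean w).
Proof. exact: Rintegral_mean. Qed.

Lemma sample_kernel_measurable :
  measurable_fun [set: past Z J0 * (T * T)] (fun u : past Z J0 * (T * T) =>
    sample_mean u.1 (fun x => z (x, u.2.1) * z (x, u.2.2))).
Proof.
apply: measurable_funM => //; apply: measurable_sum => i.
have mZi : measurable_fun [set: past Z J0 * (T * T)] (fun u => Z (t i) (u.1 : Omega)).
  apply: (@measurableT_comp _ _ _ _ _ _ (fun w : past Z J0 => Z (t i) (w : Omega)) _ fst) => //.
  by apply: measurable_past_Z; exact: imset_f.
apply: measurable_funM.
  apply: (@measurableT_comp _ _ _ _ _ _ z _ (fun u : past Z J0 * (T * T) =>
    (Z (t i) (u.1 : Omega), u.2.1))) => //.
  apply/measurable_fun_pairP; split => //.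
  exact: (measurableT_comp measurable_fst measurable_snd).
apply: (@measurableT_comp _ _ _ _ _ _ z _ (fun u : past Z J0 * (T * T) =>
    (Z (t i) (u.1 : Omega), u.2.2))) => //.
apply/measurable_fun_pairP; split => //.
exact: (measurableT_comp measurable_snd measurable_snd).
Qed.

Lemma population_kernel_measurable :
  measurable_fun [set: past Z J0 * (T * T)] (fun u : past Z J0 * (T * T) =>
    population_mean u.1 (fun x => z (x, u.2.1) * z (x, u.2.2))).
Proof.
apply: (@measurableT_comp _ _ _ _ _ _
  (fun v : T * T => \int[mu]_x (z (x, v.1) * z (x, v.2))) _ snd) => //.
apply: (bmeas_Rintegral (nu \x nu)%E mu
  (k := fun v : (T * T) * T => z (v.2, v.1.1) * z (v.2, v.1.2)) _).1.
apply: bmeasM.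
  apply: (@bmeas_comp _ _ _ _ _ z (fun v : (T * T) * T => (v.2, v.1.1))) => //.
  apply/measurable_fun_pairP; split => //; first exact: measurable_snd.
  exact: (measurableT_comp measurable_fst measurable_fst).
apply: (@bmeas_comp _ _ _ _ _ z (fun v : (T * T) * T => (v.2, v.1.2))) => //.
apply/measurable_fun_pairP; split => //; first exact: measurable_snd.
exact: (measurableT_comp measurable_snd measurable_fst).
Qed.

Lemma sample_kernel_center w y' :
  \int[nu]_y sample_mean w (fun x => z (x, y') * z (x, y)) = 0.
Proof.
have bzl x : bmeas (fun y => z (x, y)) by exact: bmeas_sectionl.
have bZ x : bmeas (fun y => z (x, y') * z (x, y)).
  by apply: bmeasM => //; exact: bmeas_cst.
rewrite bRintegralZl; last by apply: bmeas_sum => i; exact: bZ.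
rewrite bRintegral_sum//.
by rewrite big1 ?mulr0// => i _; rewrite bRintegralZl// z_center mulr0.
Qed.

Lemma population_kernel_center w y' :
  \int[nu]_y population_mean w (fun x => z (x, y') * z (x, y)) = 0.
Proof.
have bzz : bmeas (fun v : T * T => z (v.1, y') * z v).
  apply: bmeasM => //; apply: (@bmeas_comp _ _ _ _ _ z (fun v : T * T => (v.1, y'))) => //.
  by apply/measurable_fun_pairP; split; [exact: measurable_fst|exact: measurable_cst].
rewrite -(bFubini mu nu bzz) -[RHS](bRintegral_cst mu).
apply: eq_Rintegral => x _ /=.
by rewrite bRintegralZl ?z_center ?mulr0//; exact: bmeas_sectionl.
Qed.

End two_deviations.

(** * Stability of the empirical density *)

Section stability.
Context {R : realType}.
Implicit Types a b m M : R.

Lemma expR_sub_ge a b : expR b * (a - b) <= expR a - expR b.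
Proof.
have h := ler_wpM2l (expR_ge0 b) (expR_ge1Dx (a - b)).
by rewrite -expRD subrKC mulrDr mulr1 in h; lra.
Qed.

Lemma expR_Lipschitz a b M : a <= M -> b <= M ->
  `|expR a - expR b| <= expR M * `|a - b|.
Proof.
have H u v : u <= M -> expR u - expR v <= expR M * `|u - v|.
  move=> uM; have := expR_sub_ge v u.
  have h : expR u * (u - v) <= expR M * `|u - v|.
    rewrite (le_trans (ler_norm _))// normrM ger0_norm ?expR_ge0//.
    by rewrite ler_wpM2r// ler_expR.
  by lra.
move=> aM bM; rewrite ler_norml; apply/andP; split.
  by rewrite lerNl opprB distrC; exact: H.
exact: H.
Qed.

Lemma expR_coLipschitz a b m : m <= a -> m <= b ->
  expR m * `|a - b| <= `|expR a - expR b|.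
Proof.
wlog ab : a b / b <= a => [H ma mb|ma mb].
  have [ba|/ltW ab] := leP b a; first exact: H.
  by rewrite (distrC a) (distrC (expR a)); exact: H.
rewrite !ger0_norm ?subr_ge0 ?ler_expR//.
rewrite (le_trans _ (expR_sub_ge a b))// ler_wpM2r ?subr_ge0//.
by rewrite ler_expR.
Qed.

Lemma expR_monotone a b m : m <= a -> m <= b ->
  expR m * (a - b) ^+ 2 <= (expR a - expR b) * (a - b).
Proof.
have H u v : m <= v -> v <= u ->
    expR m * (u - v) ^+ 2 <= (expR u - expR v) * (u - v).
  move=> mv vu; rewrite expr2 mulrA ler_wpM2r ?subr_ge0//.
  by rewrite (le_trans _ (expR_sub_ge u v))// ler_wpM2r ?subr_ge0// ler_expR.
move=> ma mb; have [ab|/ltW ab] := leP b a; first exact: H.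
by have := H b a ma ab; rewrite !expr2; lra.
Qed.

Variables (eta : R) (n : nat).
Hypotheses (eta_gt0 : 0 < eta) (n_gt0 : (0 < n)%N).

Let n0 : 0 < n%:R :> R. Proof. by rewrite ltr0n. Qed.

Let eta_between lo hi r : lo <= r <= hi -> eta * lo <= eta * r <= eta * hi.
Proof. by move=> /andP[h1 h2]; rewrite !ler_pM2l// h1 h2. Qed.

(** The arithmetic mean of [n] numbers. *)
Definition average (F : 'I_n -> R) : R := n%:R^-1 * \sum_(i < n) F i.

Lemma averageD F G : average (fun i => F i + G i) = average F + average G.
Proof. by rewrite /average big_split mulrDr. Qed.

Lemma averageZ r F : average (fun i => r * F i) = r * average F.
Proof. by rewrite /average -mulr_sumr mulrCA. Qed.

Lemma average_cst r : average (fun=> r) = r.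
Proof. by rewrite /average sumr_const card_ord -[r *+ n]mulr_natl mulKf ?gt_eqF. Qed.

Lemma average_le F G : (forall i, F i <= G i) -> average F <= average G.
Proof. by move=> FG; rewrite /average ler_wpM2l ?invr_ge0 ?ler_sum// ltW. Qed.

Lemma averageN F : average (fun i => - F i) = - average F.
Proof. by rewrite /average sumrN mulrN. Qed.

Lemma averageB F G : average (fun i => F i - G i) = average F - average G.
Proof. by rewrite averageD averageN. Qed.

Lemma average_ge0 F : (forall i, 0 <= F i) -> 0 <= average F.
Proof. by move=> F0; rewrite -[leLHS](average_cst 0); exact: average_le. Qed.

Lemma average_exchange (F : 'I_n -> 'I_n -> R) :
  average (fun i => average (F i)) = average (fun j => average (F^~ j)).
Proof.
by rewrite /average -!mulr_sumr exchange_big.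
Qed.

Lemma average_norm F : `|average F| <= average (fun i => `|F i|).
Proof.
by rewrite /average normrM gtr0_norm ?invr_gt0// ler_wpM2l ?ler_norm_sum.
Qed.

Lemma average_sqr F : average F ^+ 2 <= average (fun i => F i ^+ 2).
Proof.
rewrite -subr_ge0.
rewrite (_ : _ - _ = average (fun i => (F i - average F) ^+ 2)).
  by apply: average_ge0 => i; exact: sqr_ge0.
have -> : (fun i => (F i - average F) ^+ 2) =
    fun i => F i ^+ 2 - (2 * average F) * F i + average F ^+ 2.
  by apply/funext => i; ring.
by rewrite averageD averageB averageZ average_cst; ring.
Qed.

(** The bounds on the empirical potentials follow from the two extension
equations and the normalization alone: [g] oscillates by at most 1 and has
mean 0 on the sample, and [f] is a soft minimum of [c - g]. *)
Lemma potentials_bound (T1 T2 : Type) (DX : set T1) (DY : set T2)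
    (c : T1 -> T2 -> R) (x : 'I_n -> T1) (y : 'I_n -> T2) (f : T1 -> R)
    (g : T2 -> R) :
  (forall u v, DX u -> DY v -> 0 <= c u v <= 1) ->
  (forall i, DX (x i)) -> (forall j, DY (y j)) ->
  average (fun j => g (y j)) = 0 ->
  (forall u, DX u -> expR (- eta * f u) =
     average (fun j => expR (- eta * c u (y j) + eta * g (y j)))) ->
  (forall v, DY v -> expR (- eta * g v) =
     average (fun i => expR (- eta * c (x i) v + eta * f (x i)))) ->
  (forall u, DX u -> -1 <= f u <= 2) /\ (forall v, DY v -> -1 <= g v <= 1).
Proof.
move=> c01 xD yD g0 fE gE.
pose A := average (fun i => expR (eta * f (x i))).
have A0 : 0 < A.
  rewrite /A /average mulr_gt0 ?invr_gt0//.
  rewrite (bigD1 (Ordinal n_gt0))//=; apply: ltr_pwDl; first exact: expR_gt0.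
  by apply: sumr_ge0 => i _; exact: expR_ge0.
pose a := eta^-1 * ln A.
have AE : A = expR (eta * a) by rewrite /a mulVKf ?gt_eqF// lnK.
have gb v : DY v -> - a <= g v <= 1 - a.
  move=> Dv.
  have h1 : expR (- eta * g v) <= A.
    rewrite (gE _ Dv); apply: average_le => i; rewrite ler_expR.
    by have /eta_between/andP[c0 c1] := c01 _ _ (xD i) Dv; lra.
  have h2 : expR (- eta) * A <= expR (- eta * g v).
    rewrite (gE _ Dv) -averageZ; apply: average_le => i; rewrite -expRD ler_expR.
    by have /eta_between/andP[c0 c1] := c01 _ _ (xD i) Dv; lra.
  rewrite AE ler_expR in h1; rewrite AE -expRD ler_expR in h2.
  by apply/andP; split; rewrite -(ler_pM2l eta_gt0); lra.
have a0 : 0 <= a <= 1.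
  have l : - a <= average (fun j => g (y j)).
    by rewrite -[leLHS]average_cst; apply: average_le => j; case/andP: (gb _ (yD j)).
  have r : average (fun j => g (y j)) <= 1 - a.
    by rewrite -[leRHS]average_cst; apply: average_le => j; case/andP: (gb _ (yD j)).
  by rewrite g0 in l r; apply/andP; split; lra.
have gb' v : DY v -> -1 <= g v <= 1.
  by move=> /gb; lra.
split => // u Du.
have h1 : expR (- eta * f u) <= expR eta.
  rewrite (fE _ Du) -[leRHS]average_cst; apply: average_le => j; rewrite ler_expR.
  have /eta_between/andP[c0 c1] := c01 _ _ Du (yD j).
  by have /eta_between/andP[g1 g2] := gb' _ (yD j); lra.
have h2 : expR (- (2 * eta)) <= expR (- eta * f u).
  rewrite (fE _ Du) -[leLHS]average_cst; apply: average_le => j; rewrite ler_expR.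
  have /eta_between/andP[c0 c1] := c01 _ _ Du (yD j).
  by have /eta_between/andP[g1 g2] := gb' _ (yD j); lra.
rewrite ler_expR in h1; rewrite ler_expR in h2.
by apply/andP; split; rewrite -(ler_pM2l eta_gt0); lra.
Qed.

(** Strong concavity of the empirical dual objective: [(F, G)] is its maximizer
(its marginal conditions hold exactly), while the gradient at [(F', G')] is the
pair of averages of [1 - q].  The normalization of [G - G'] removes the
direction of shifts by a constant, in which the objective is flat. *)
Lemma dual_strong_concavity (C : 'I_n -> 'I_n -> R) (F G F' G' : 'I_n -> R) :
  let p i j := expR (- eta * (C i j - F i - G j)) in
  let q i j := expR (- eta * (C i j - F' i - G' j)) in
  (forall i, average (p i) = 1) -> (forall j, average (p^~ j) = 1) ->
  average (fun j => G j - G' j) = 0 ->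
  (forall i j, C i j - F i - G j <= 3) ->
  (forall i j, C i j - F' i - G' j <= 3) ->
  eta ^+ 2 * (average (fun i => (F i - F' i) ^+ 2) +
              average (fun j => (G j - G' j) ^+ 2)) <=
  expR (6 * eta) * (average (fun i => (average (fun j => 1 - q i j)) ^+ 2) +
                    average (fun j => (average (fun i => 1 - q i j)) ^+ 2)).
Proof.
move=> p q rowp colp G0 hp hq.
pose phi i := F i - F' i; pose psi j := G j - G' j.
pose u i := average (fun j => 1 - q i j); pose v j := average (fun i => 1 - q i j).
set S := average (fun i => phi i ^+ 2) + average (fun j => psi j ^+ 2).
set U := average (fun i => u i ^+ 2) + average (fun j => v j ^+ 2).
(* the monotonicity of expR, summed over the sample; the cross term vanishes
   because psi has mean 0 *)
have lower : eta * expR (- (3 * eta)) * S <=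
    average (fun i => average (fun j => (p i j - q i j) * (phi i + psi j))).
  have -> : S = average (fun i => average (fun j => (phi i + psi j) ^+ 2)).
    have E i : average (fun j => (phi i + psi j) ^+ 2) =
        phi i ^+ 2 + average (fun j => psi j ^+ 2).
      have -> : (fun j => (phi i + psi j) ^+ 2) =
          fun j => (phi i ^+ 2 + (2 * phi i) * psi j) + psi j ^+ 2.
        by apply/funext => j; ring.
      by rewrite !averageD averageZ average_cst G0 mulr0 addr0.
    under [in RHS]eq_fun do rewrite E.
    by rewrite averageD average_cst.
  rewrite -averageZ; apply: average_le => i.
  rewrite -averageZ; apply: average_le => j.
  have := @expR_monotone (- eta * (C i j - F i - G j))
    (- eta * (C i j - F' i - G' j)) (- (3 * eta)).
  have -> : - eta * (C i j - F i - G j) - - eta * (C i j - F' i - G' j) =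
      eta * (phi i + psi j) by rewrite /phi /psi; ring.
  rewrite -/(p i j) -/(q i j).
  have lp : - (3 * eta) <= - eta * (C i j - F i - G j) by have := ler_wpM2l (ltW eta_gt0) (hp i j); lra.
  have lq : - (3 * eta) <= - eta * (C i j - F' i - G' j) by have := ler_wpM2l (ltW eta_gt0) (hq i j); lra.
  move=> /(_ lp lq) h; rewrite -(ler_pM2l eta_gt0).
  by move: h; rewrite exprMn; lra.
(* the same quantity computed from the marginals of p and q *)
have upper : average (fun i => average (fun j => (p i j - q i j) * (phi i + psi j))) =
    average (fun i => phi i * u i) + average (fun j => psi j * v j).
  have -> : (fun i => average (fun j => (p i j - q i j) * (phi i + psi j))) =
     fun i => phi i * u i + average (fun j => psi j * (p i j - q i j)).
    apply/funext => i.
    have -> : (fun j => (p i j - q i j) * (phi i + psi j)) =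
       fun j => phi i * (p i j - q i j) + psi j * (p i j - q i j).
      by apply/funext => j; ring.
    by rewrite averageD averageZ averageB rowp /u averageB average_cst.
  rewrite averageD; congr (_ + _); rewrite average_exchange.
  congr average; apply/funext => j.
  by rewrite averageZ averageB colp /v averageB average_cst.
set d := eta * expR (- (3 * eta)) in lower.
have d0 : 0 < d by rewrite mulr_gt0// expR_gt0.
have S0 : 0 <= S by apply: addr_ge0; apply: average_ge0 => i; exact: sqr_ge0.
have young r w : r * w <= d / 2 * r ^+ 2 + (2 * d)^-1 * w ^+ 2.
  rewrite -subr_ge0.
  rewrite (_ : _ - _ = (2 * d)^-1 * (d * r - w) ^+ 2); last by field; rewrite gt_eqF.
  by rewrite mulr_ge0 ?sqr_ge0// invr_ge0 mulr_ge0// ltW.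
have bound : d * S <= d / 2 * S + (2 * d)^-1 * U.
  rewrite (le_trans lower)// upper /S /U !mulrDr.
  have -> a1 a2 a3 a4 : a1 + a2 + (a3 + a4) = (a1 + a3) + (a2 + a4) :> R by ring.
  rewrite -!averageZ -!averageD.
  by apply: average_le => i; apply: lerD; exact: young.
have dS : d ^+ 2 * S <= U.
  have h : d * (d * S) <= d * (d / 2 * S + (2 * d)^-1 * U) by rewrite ler_wpM2l// ltW.
  have e : d * ((2 * d)^-1 * U) = U / 2 by field; rewrite gt_eqF.
  by rewrite (mulrDr d (d / 2 * S)) e in h; lra.
have e3 : expR (6 * eta) * expR (- (3 * eta)) ^+ 2 = 1.
  rewrite -expRM_natl -expRD -[RHS]expR0; congr expR; ring.
rewrite -/S -/U (_ : eta ^+ 2 * S = expR (6 * eta) * (d ^+ 2 * S)).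
  by rewrite ler_wpM2l// expR_ge0.
rewrite -[LHS]mul1r -[X in X * _ = _]e3 /d exprMn.
by move: (expR _) (expR _ ^+ 2) (eta ^+ 2) (S) => *; ring.
Qed.

(** Stability of the canonical extension at one point: [f] and [f'] are
determined by the values [G] and [G'] of the other potential on the sample, up
to the error [u] in the equation of [f']. *)
Lemma extension_stability (k G G' : 'I_n -> R) (f f' u : R) :
  (forall j, 0 <= k j <= 1) -> (forall j, G j <= 3) -> (forall j, G' j <= 3) ->
  f <= 3 -> -2 <= f' <= 3 ->
  expR (- eta * f) = average (fun j => k j * expR (eta * G j)) ->
  expR (- eta * f') * (1 - u) = average (fun j => k j * expR (eta * G' j)) ->
  eta ^+ 2 * (f - f') ^+ 2 <=
  2 * expR (12 * eta) * (eta ^+ 2 * average (fun j => (G j - G' j) ^+ 2) + u ^+ 2).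
Proof.
move=> k01 G3 G'3 f3 /andP[f'2 f'3] fE f'E.
set D := average (fun j => `|G j - G' j|).
have D0 : 0 <= D by exact: average_ge0.
have h1 : `|expR (- eta * f) - expR (- eta * f')| <=
    expR (3 * eta) * (eta * D + `|u|).
  have -> : expR (- eta * f) - expR (- eta * f') =
     average (fun j => k j * (expR (eta * G j) - expR (eta * G' j))) -
     expR (- eta * f') * u.
    have -> : (fun j => k j * (expR (eta * G j) - expR (eta * G' j))) =
        fun j => k j * expR (eta * G j) - k j * expR (eta * G' j).
      by apply/funext => j; ring.
    by rewrite averageB -fE -f'E; ring.
  rewrite mulrDr (le_trans (ler_normB _ _))// lerD//.
    rewrite (le_trans (average_norm _))// mulrA -averageZ; apply: average_le => j.
    case/andP: (k01 j) => k0 k1; rewrite normrM ger0_norm//.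
    apply: (@le_trans _ _ `|expR (eta * G j) - expR (eta * G' j)|).
      by rewrite ler_piMl.
    have := @expR_Lipschitz (eta * G j) (eta * G' j) (3 * eta).
    rewrite -mulrBr normrM (gtr0_norm eta_gt0) mulrA; apply.
      by rewrite [leRHS]mulrC ler_pM2l.
    by rewrite [leRHS]mulrC ler_pM2l.
  rewrite normrM ger0_norm ?expR_ge0// ler_wpM2r// ler_expR.
  have h := ler_wpM2l (ltW eta_gt0) f'2; rewrite mulNr lerNl (le_trans _ h)//.
  by rewrite mulrN lerN2 mulrC ler_pM2r// ler_nat.
have h2 : expR (- (3 * eta)) * (eta * `|f - f'|) <=
    `|expR (- eta * f) - expR (- eta * f')|.
  have := @expR_coLipschitz (- eta * f) (- eta * f') (- (3 * eta)).
  rewrite -mulrBr normrM normrN (gtr0_norm eta_gt0); apply.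
    by have := ler_wpM2l (ltW eta_gt0) (f3); lra.
  by have := ler_wpM2l (ltW eta_gt0) (f'3); lra.
have h3 : eta * `|f - f'| <= expR (6 * eta) * (eta * D + `|u|).
  have e : expR (3 * eta) * expR (- (3 * eta)) = 1 by rewrite -expRD subrr expR0.
  have e6 : expR (6 * eta) = expR (3 * eta) * expR (3 * eta).
    by rewrite -expRD; congr expR; ring.
  have := ler_wpM2l (expR_ge0 (3 * eta)) (le_trans h2 h1).
  by rewrite [X in X <= _ -> _]mulrA e mul1r [X in _ <= X -> _]mulrA -e6.
have h4 : eta ^+ 2 * (f - f') ^+ 2 <= expR (6 * eta) ^+ 2 * (eta * D + `|u|) ^+ 2.
  rewrite -!exprMn -[leLHS]ger0_norm ?sqr_ge0// normrX lerXn2r//.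
  - by rewrite nnegrE mulr_ge0 ?expR_ge0// addr_ge0// mulr_ge0// ltW.
  - by rewrite normrM (gtr0_norm eta_gt0).
have e12 : expR (6 * eta) ^+ 2 = expR (12 * eta).
  by rewrite -expRM_natl; congr expR; ring.
rewrite e12 in h4; apply: (le_trans h4).
rewrite (mulrC 2) -[leRHS]mulrA ler_wpM2l ?expR_ge0//.
have DS : D ^+ 2 <= average (fun j => (G j - G' j) ^+ 2).
  rewrite (le_trans (average_sqr _))//; apply: average_le => j.
  by rewrite real_normK// num_real.
have : 0 <= (eta * D - `|u|) ^+ 2 by exact: sqr_ge0.
have u2 : `|u| ^+ 2 = u ^+ 2 by rewrite real_normK// num_real.
have := ler_wpM2l (sqr_ge0 eta) DS.
by rewrite -u2 !exprS !expr0; lra.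
Qed.

(** The deterministic bound: [p] is the empirical density, normalized by the
extension equations on the sample [x], [y], and [q] the density of any pair of
bounded potentials. *)
Lemma density_stability (T1 T2 : Type) (DX : set T1) (DY : set T2)
    (c : T1 -> T2 -> R) (x : 'I_n -> T1) (y : 'I_n -> T2) (f f0 : T1 -> R)
    (g g0 : T2 -> R) :
  let p u v := expR (- eta * (c u v - f u - g v)) in
  let q u v := expR (- eta * (c u v - f0 u - g0 v)) in
  (forall u v, DX u -> DY v -> 0 <= c u v <= 1) ->
  (forall i, DX (x i)) -> (forall j, DY (y j)) ->
  average (fun j => g (y j)) = 0 ->
  (forall u, DX u -> expR (- eta * f u) =
     average (fun j => expR (- eta * c u (y j) + eta * g (y j)))) ->
  (forall v, DY v -> expR (- eta * g v) =
     average (fun i => expR (- eta * c (x i) v + eta * f (x i)))) ->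
  (forall u, -1 <= f0 u <= 2) -> (forall v, -1 <= g0 v <= 1) ->
  forall u v, DX u -> DY v ->
  (p u v - q u v) ^+ 2 <= 4 * expR (24 * eta) *
    (average (fun i => (average (fun j => 1 - q (x i) (y j))) ^+ 2) +
     average (fun j => (average (fun i => 1 - q (x i) (y j))) ^+ 2) +
     ((average (fun j => 1 - q u (y j))) ^+ 2 +
      (average (fun i => 1 - q (x i) v)) ^+ 2)).
Proof.
move=> p q c01 xD yD gmean fE gE f0b g0b u v Du Dv.
have [fb gb] := potentials_bound c01 xD yD gmean fE gE.
(* the population potentials shifted by a constant so that the second one
   agrees on average with g over the sample *)
pose s := average (fun j => g0 (y j)).
have sb : -1 <= s <= 1.
  rewrite -[X in X <= _ <= _]average_cst -[X in _ <= _ <= X]average_cst.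
  by apply/andP; split; apply: average_le => j; case/andP: (g0b (y j)).
pose f' x0 := f0 x0 + s; pose g' y0 := g0 y0 - s.
have f'b x0 : -2 <= f' x0 <= 3.
  by have := f0b x0; rewrite /f'; lra.
have g'b y0 : -2 <= g' y0 <= 3.
  by have := g0b y0; rewrite /g'; lra.
have qE x0 y0 : q x0 y0 = expR (- eta * (c x0 y0 - f' x0 - g' y0)).
  by congr expR; rewrite /f' /g'; ring.
have cp x0 y0 : DX x0 -> DY y0 -> c x0 y0 - f x0 - g y0 <= 3.
  by move=> Dx Dy; have := fb _ Dx; have := gb _ Dy; have := c01 _ _ Dx Dy; lra.
have cq0 x0 y0 : DX x0 -> DY y0 -> c x0 y0 - f0 x0 - g0 y0 <= 3.
  by move=> Dx Dy; have := f0b x0; have := g0b y0; have := c01 _ _ Dx Dy; lra.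
have cq x0 y0 : DX x0 -> DY y0 -> c x0 y0 - f' x0 - g' y0 <= 3.
  by move=> Dx Dy; have := cq0 _ _ Dx Dy; rewrite /f' /g'; lra.
set X := average (fun i => (f (x i) - f' (x i)) ^+ 2).
set Y := average (fun j => (g (y j) - g' (y j)) ^+ 2).
have energy : eta ^+ 2 * (X + Y) <= expR (6 * eta) *
    (average (fun i => (average (fun j => 1 - q (x i) (y j))) ^+ 2) +
     average (fun j => (average (fun i => 1 - q (x i) (y j))) ^+ 2)).
  have -> : q = fun x0 y0 => expR (- eta * (c x0 y0 - f' x0 - g' y0)).
    by apply/funext => x0; apply/funext => y0; exact: qE.
  apply: (@dual_strong_concavity (fun i j => c (x i) (y j)) (fun i => f (x i))
    (fun j => g (y j)) (fun i => f' (x i)) (fun j => g' (y j))).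
  - move=> i; rewrite -[RHS](_ : expR (eta * f (x i)) * expR (- eta * f (x i)) = 1).
      rewrite fE// -averageZ; congr average; apply/funext => j.
      by rewrite -expRD; congr expR; ring.
    by rewrite -expRD -[RHS]expR0; congr expR; ring.
  - move=> j; rewrite -[RHS](_ : expR (eta * g (y j)) * expR (- eta * g (y j)) = 1).
      rewrite gE// -averageZ; congr average; apply/funext => i.
      by rewrite -expRD; congr expR; ring.
    by rewrite -expRD -[RHS]expR0; congr expR; ring.
  - by rewrite averageB gmean /g' averageB average_cst -/s subrr subr0.
  - by move=> i j; exact: cp.
  - by move=> i j; exact: cq.
set U := _ + average _ in energy.
have hf : eta ^+ 2 * (f u - f' u) ^+ 2 <=
    2 * expR (12 * eta) * (eta ^+ 2 * Y + average (fun j => 1 - q u (y j)) ^+ 2).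
  apply: (@extension_stability (fun j => expR (- eta * c u (y j)))) => //.
  - move=> j; rewrite expR_ge0/= -expR0 ler_expR.
    by have /eta_between/andP[] := c01 _ _ Du (yD j); lra.
  - by move=> j; have := gb _ (yD j); lra.
  - by move=> j; case/andP: (g'b (y j)).
  - by have := fb _ Du; lra.
  - by rewrite fE//; congr average; apply/funext => j; rewrite -expRD.
  - rewrite averageB average_cst opprB addrC subrK -averageZ.
    congr average; apply/funext => j; rewrite qE -!expRD; congr expR; ring.
have hg : eta ^+ 2 * (g v - g' v) ^+ 2 <=
    2 * expR (12 * eta) * (eta ^+ 2 * X + average (fun i => 1 - q (x i) v) ^+ 2).
  apply: (@extension_stability (fun i => expR (- eta * c (x i) v))) => //.
  - move=> i; rewrite expR_ge0/= -expR0 ler_expR.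
    by have /eta_between/andP[] := c01 _ _ (xD i) Dv; lra.
  - by move=> i; have := fb _ (xD i); lra.
  - by move=> i; case/andP: (f'b (x i)).
  - by have := gb _ Dv; lra.
  - by rewrite gE//; congr average; apply/funext => i; rewrite -expRD.
  - rewrite averageB average_cst opprB addrC subrK -averageZ.
    congr average; apply/funext => i; rewrite qE -!expRD; congr expR; ring.
have hpq : (p u v - q u v) ^+ 2 <=
    expR (6 * eta) * (2 * (eta ^+ 2 * (f u - f' u) ^+ 2 + eta ^+ 2 * (g v - g' v) ^+ 2)).
  have low x0 y0 (a b : R) : DX x0 -> DY y0 -> a <= 2 -> b <= 1 ->
      - eta * (c x0 y0 - a - b) <= 3 * eta.
    move=> Dx Dy a2 b1; have [c0 _] := andP (c01 _ _ Dx Dy).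
    have h : -3 <= c x0 y0 - a - b by lra.
    have := ler_wpM2l (ltW eta_gt0) h.
    by rewrite mulrN => h2; rewrite mulNr lerNl (le_trans _ h2)// mulrC.
  have h := @expR_Lipschitz (- eta * (c u v - f u - g v))
    (- eta * (c u v - f' u - g' v)) (3 * eta).
  have h3 : `|p u v - q u v| <= expR (3 * eta) * `|eta * (f u - f' u) + eta * (g v - g' v)|.
    rewrite qE /p (le_trans (h _ _))//.
    - by apply: low => //; [have := fb _ Du; lra|have := gb _ Dv; lra].
    - have -> : c u v - f' u - g' v = c u v - f0 u - g0 v by rewrite /f' /g'; ring.
      by apply: low => //; [have := f0b u; lra|have := g0b v; lra].
    - rewrite ler_wpM2l ?expR_ge0//.
      have -> : - eta * (c u v - f u - g v) - - eta * (c u v - f' u - g' v) =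
        eta * (f u - f' u) + eta * (g v - g' v) by ring.
      by [].
  have e6 : expR (6 * eta) = expR (3 * eta) ^+ 2.
    by rewrite -expRM_natl; congr expR; ring.
  have h4 : (p u v - q u v) ^+ 2 <=
      expR (6 * eta) * (eta * (f u - f' u) + eta * (g v - g' v)) ^+ 2.
    rewrite -(ger0_norm (sqr_ge0 (p u v - q u v))) normrX e6.
    rewrite -(ger0_norm (sqr_ge0 (_ + _))) normrX -exprMn lerXn2r//.
    by rewrite nnegrE mulr_ge0// expR_ge0.
  rewrite (le_trans h4)// ler_wpM2l ?expR_ge0// -!exprMn.
  move: (eta * (f u - f' u)) (eta * (g v - g' v)) => a b.
  have := sqr_ge0 (a - b); rewrite !expr2; lra.
set W := average _ ^+ 2 + average _ ^+ 2.
have W0 : 0 <= W by rewrite addr_ge0 ?sqr_ge0.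
have U0 : 0 <= U by apply: addr_ge0; apply: average_ge0 => ?; exact: sqr_ge0.
have e18 : expR (6 * eta) * expR (12 * eta) = expR (18 * eta).
  by rewrite -expRD; congr expR; ring.
have e24 : expR (18 * eta) * expR (6 * eta) = expR (24 * eta).
  by rewrite -expRD; congr expR; ring.
have step : (p u v - q u v) ^+ 2 <= 4 * expR (18 * eta) * (eta ^+ 2 * (X + Y) + W).
  rewrite (le_trans hpq)// -e18 (_ : 4 * _ * _ = expR (6 * eta) * (2 *
    (2 * expR (12 * eta) * (eta ^+ 2 * (X + Y) + W)))); last by ring.
  rewrite ler_wpM2l ?expR_ge0// ler_wpM2l//.
  rewrite (_ : _ * (_ + W) =
    2 * expR (12 * eta) * (eta ^+ 2 * Y + average (fun j => 1 - q u (y j)) ^+ 2) +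
    2 * expR (12 * eta) * (eta ^+ 2 * X + average (fun i => 1 - q (x i) v) ^+ 2)).
    exact: lerD.
  by rewrite /W; ring.
have E0 : 0 <= 4 * expR (18 * eta) by rewrite mulr_ge0// expR_ge0.
rewrite (le_trans step)// -e24 mulrA -(mulrA _ (expR (6 * eta))).
rewrite (ler_wpM2l E0)// (mulrDr _ U) lerD//.
by rewrite ler_peMl// -expR0 ler_expR mulr_ge0// ltW.
Qed.

End stability.

(** * The two losses as integrals *)

Section integration_tools.
Context {d : measure_display} {T : measurableType d} {R : realType}.

Lemma L2_dist_sqE (m : {measure set T -> \bar R}) (f g : T -> R) :
  L2_dist_sq m f g = (\int[m]_z ((f z - g z) ^+ 2)%:E)%E.
Proof.
rewrite /L2_dist_sq unlock.
have -> : (\int[m]_x `|(f x - g x)%:E| `^ 2 = \int[m]_z ((f z - g z) ^+ 2)%:E)%E.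
  apply: eq_integral => z _; rewrite abse_EFin poweR_EFin.
  by rewrite (powR_mulrn 2)// real_normK// num_real.
by rewrite poweR12_sqrt ?sqr_sqrte//; apply: integral_ge0 => z _; rewrite lee_fin sqr_ge0.
Qed.

(** The integral of a nonnegative function is a supremum over the simple
functions below it, so it is monotone without any measurability. *)
Lemma ge0_le_integral_lower (m : {measure set T -> \bar R}) (f h : T -> \bar R) :
  (forall x, 0 <= f x)%E -> (forall x, f x <= h x)%E ->
  (\int[m]_x f x <= \int[m]_x h x)%E.
Proof.
move=> f0 fh; have h0 x : (0 <= h x)%E by exact: le_trans (f0 x) (fh x).
rewrite !ge0_integralTE//; apply: le_ereal_sup => _ [k kf <-].
by exists k => // x; exact: le_trans (kf x) (fh x).
Qed.

(** Only the upper function needs to be measurable: it may be raised to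
infinity on a null set without changing its integral. *)
Lemma ae_ge0_le_integral_lower (m : {measure set T -> \bar R}) (f h : T -> \bar R) :
  measurable_fun [set: T] h -> (forall x, 0 <= f x)%E -> (forall x, 0 <= h x)%E ->
  {ae m, forall x, (f x <= h x)%E} ->
  (\int[m]_x f x <= \int[m]_x h x)%E.
Proof.
move=> mh f0 h0 [N [mN N0 fh]].
pose h' x := if x \in N then +oo%E else h x.
have mh' : measurable_fun [set: T] h'.
  apply: measurable_fun_ifT => //.
  apply: (measurable_fun_bool true); rewrite setTI.
  by rewrite (_ : _ @^-1` _ = N)//; apply/seteqP; split=> x; [exact: set_mem|exact: mem_set].
apply: (@le_trans _ _ (\int[m]_x h' x)%E).
  apply: ge0_le_integral_lower => // x; rewrite /h'; case: ifPn => [_|/negP].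
    by rewrite leey.
  rewrite in_setE => xN; apply/negPn/negP => h1; apply: xN; apply: fh => /=.
  exact/negP.
rewrite le_eqVlt; apply/orP; left; apply/eqP; apply: ae_eq_integral => //.
exists N; split => // x /= h1; apply: contrapT => xN; apply: h1 => _.
by rewrite /h' memNset.
Qed.

Lemma integral_empirical n (x : 'I_n -> T) (f : T -> \bar R) :
  (0 < n)%N -> measurable_fun [set: T] f -> (forall u, 0 <= f u)%E ->
  (\int[empirical x]_u f u = (n%:R^-1)%:E * \sum_(i < n) f (x i))%E.
Proof.
move=> n0 mf f0.
pose atom k : {measure set T -> \bar R} := \d_(x (insubd (Ordinal n0) k)).
have n1 : 0 <= n%:R^-1 :> R by rewrite invr_ge0.
transitivity (\int[mscale (NngNum n1) (msum atom n)]_u f u)%E.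
  apply: eq_measure_integral => A mA _.
  rewrite /= /empirical /mscale/= /msum; congr (_ * _)%E.
  by apply: eq_bigr => i _; rewrite /atom valKd.
rewrite ge0_integral_mscale//= ge0_integral_measure_sum//; congr (_ * _)%E.
apply: eq_bigr => i _.
by rewrite integral_dirac//= diracT mul1e valKd.
Qed.

Lemma Rintegral_empirical n (x : 'I_n -> T) (f : T -> R) :
  (0 < n)%N -> measurable_fun [set: T] f ->
  \int[empirical x]_u f u = n%:R^-1 * \sum_(i < n) f (x i).
Proof.
move=> n0 mf; have mEf : measurable_fun [set: T] (EFin \o f) by exact/measurable_EFinP.
rewrite /Rintegral integralE !integral_empirical//.
- have -> : (\sum_(i < n) (fun x0 : T => (f x0)%:E)^\+%E (x i))%R =
      (\sum_(i < n) Num.max (f (x i)) 0)%:E.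
    by rewrite -sumEFin; apply: eq_bigr => i _; rewrite funeposE -EFin_max.
  have -> : (\sum_(i < n) (fun x0 : T => (f x0)%:E)^\-%E (x i))%R =
      (\sum_(i < n) Num.max (- f (x i)) 0)%:E.
    by rewrite -sumEFin; apply: eq_bigr => i _; rewrite funenegE -EFin_max.
  rewrite -!EFinM -EFinB /= -mulrBr -sumrB; congr (_ * _).
  apply: eq_bigr => i _; have [fx|fx] := leP (f (x i)) 0.
    by rewrite max_l ?oppr_ge0// opprK add0r.
  by rewrite max_r ?subr0// oppr_le0 ltW.
- exact: measurable_funeneg.
- exact: measurable_funepos.
Qed.

End integration_tools.

(** * Convergence rates *)

(** A nonnegative random variable of order [r]: mean at most [2 * r], and
exponential tails at the scale [r]. *)
Definition subexponential_at_rate dO (Omega : measurableType dO) (R : realType)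
    (P : probability Omega R) (r : R) (U : Omega -> R) :=
  [/\ measurable_fun [set: Omega] U, forall w, 0 <= U w,
      (\int[P]_w (U w)%:E <= (2 * r)%:E)%E &
      forall t : R, (P [set w | (r * t < U w)%R] <= (2 * expR (- t))%:E)%E].

Section subexponential_deviations.
Context {dO dT : measure_display} {Omega : measurableType dO}
  {T : measurableType dT} {R : realType} {P : probability Omega R}.
Context {I : finType}.
Variables (Z : I -> {RV P >-> T}) (n : nat) (s t : nat -> I).
Variables (mu nu : probability T R) (z : T * T -> R) (b : R).
Hypotheses (indep : mutually_independent Z) (n_gt0 : (0 < n)%N) (b_gt0 : 0 < b)
  (bz : bmeas z) (z_bnd : forall x, `|z x| <= b)
  (z_center : forall x, \int[nu]_y z (x, y) = 0)
  (st : forall j k, s j != t k)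
  (s_inj : forall j k, (j < k < n)%N -> s j != s k)
  (s_law : forall k, (k < n)%N -> has_law (Z (s k)) nu).

Let J0 := [set t j | j : 'I_n].

Let s_J0 k : (k < n)%N -> s k \notin J0.
Proof.
by move=> _; apply/negP => /imsetP[j _ e]; have := st k j; rewrite e eqxx.
Qed.

Let rate : R := 32 * b ^+ 2 / n%:R.

Let rateE (a : R) : 32 * b ^+ 2 * a / n%:R = rate * a.
Proof. by rewrite mulrAC. Qed.

Lemma subexponential_sample_deviation : subexponential_at_rate P rate
  (mean_square_deviation Z n s z (sample_mean Z n t)).
Proof.
have mean w := sample_mean_mean Z t n_gt0 w.
have mK := sample_kernel_measurable (Z := Z) (n := n) (t := t) bz.1.
have Kc w y := sample_kernel_center Z n t bz.1 z_bnd z_center w y.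
split.
- exact: (measurable_deviation (J0 := J0) n s bz.1 z_bnd mean mK).
- by move=> w; exact: (deviation_ge0 Z n s bz.1 z_bnd mean).
- have := deviation_expectation indep s_J0 s_inj s_law n_gt0 b_gt0 bz.1 z_bnd mean mK Kc.
  by rewrite (_ : 64 * b ^+ 2 / n%:R = 2 * rate)// /rate; lra.
- move=> u; rewrite -rateE.
  exact: (deviation_tail indep s_J0 s_inj s_law n_gt0 b_gt0 bz.1 z_bnd mean mK Kc).
Qed.

Lemma subexponential_population_deviation : subexponential_at_rate P rate
  (mean_square_deviation Z n s z (population_mean mu)).
Proof.
have mean w := population_mean_mean mu w (Omega := Omega).
have mK := population_kernel_measurable (Z := Z) (n := n) (t := t) mu nu bz.1 z_bnd.
have Kc w y := population_kernel_center mu bz.1 z_bnd z_center w y (Omega := Omega).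
split.
- exact: (measurable_deviation (J0 := J0) n s bz.1 z_bnd mean mK).
- by move=> w; exact: (deviation_ge0 Z n s bz.1 z_bnd mean).
- have := deviation_expectation indep s_J0 s_inj s_law n_gt0 b_gt0 bz.1 z_bnd mean mK Kc.
  by rewrite (_ : 64 * b ^+ 2 / n%:R = 2 * rate)// /rate; lra.
- move=> u; rewrite -rateE.
  exact: (deviation_tail indep s_J0 s_inj s_law n_gt0 b_gt0 bz.1 z_bnd mean mK Kc).
Qed.

End subexponential_deviations.

Section convergence_rates.
Context {R : realType} {d n : nat} (eta : R).
Notation V := (d.-tuple R).
Variables (mu nu : probability V R) (pi_star : probability (V * V)%type R).
Hypotheses (eta_gt0 : 0 < eta)
  (mu_supp : {ae mu, forall x, enorm x <= 2^-1})
  (nu_supp : {ae nu, forall y, enorm y <= 2^-1})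
  (pi_starP : schrodinger_coupling eta mu nu pi_star).
Context {dO : measure_display} {Omega : measurableType dO} {P : probability Omega R}.
Variables (X Y : 'I_n.+1 -> {RV P >-> V}) (f_n g_n : Omega -> V -> R).
Hypotheses (X_law : forall i, has_law (X i) mu)
  (Y_law : forall j, has_law (Y j) nu)
  (XY_indep : mutually_independent (two_samples X Y))
  (fg_nP : forall w, empirical_potentials eta
     (fun i => X i w) (fun j => Y j w) (f_n w) (g_n w)).
Variables (f0 g0 : V -> R).
Hypotheses (mf0 : measurable_fun [set: V] f0) (mg0 : measurable_fun [set: V] g0)
  (f0_bnd : forall x, -1 <= f0 x <= 2) (g0_bnd : forall y, -1 <= g0 y <= 1)
  (row : forall x,
     \int[nu]_y expR (- eta * (capped_cost (x, y) - f0 x - g0 y)) = 1)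
  (col : forall y,
     \int[mu]_x expR (- eta * (capped_cost (x, y) - f0 x - g0 y)) = 1).

Let q (z : V * V) : R := expR (- eta * (capped_cost z - f0 z.1 - g0 z.2)).

Let b : R := expR (3 * eta).

Let b_gt0 : 0 < b. Proof. exact: expR_gt0. Qed.

Let bf0 : bmeas f0. Proof. exact: bmeas_between mf0 f0_bnd. Qed.
Let bg0 : bmeas g0. Proof. exact: bmeas_between mg0 g0_bnd. Qed.

Let bq : bmeas q.
Proof.
apply: bmeas_expR; apply: bmeasM; first exact: bmeas_cst.
apply: bmeasB; last exact: (@bmeas_comp _ _ _ _ _ g0 snd).
apply: bmeasB; last exact: (@bmeas_comp _ _ _ _ _ f0 fst).
exact: bmeas_between measurable_capped_cost capped_cost01.
Qed.

Let zY (z : V * V) : R := 1 - q z.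
Let zX (z : V * V) : R := 1 - q (z.2, z.1).

Let bzY : bmeas zY.
Proof. by apply: bmeasB => //; exact: bmeas_cst. Qed.

Let bzX : bmeas zX.
Proof. by apply: (@bmeas_comp _ _ _ _ _ zY (fun z => (z.2, z.1))) => //; exact: measurable_swap. Qed.

Let q_le z : q z <= b.
Proof.
rewrite ler_expR; have /andP[c0 _] := capped_cost01 z.
have /andP[_ f2] := f0_bnd z.1; have /andP[_ g1] := g0_bnd z.2.
have h : -3 <= capped_cost z - f0 z.1 - g0 z.2 by lra.
have := ler_wpM2l (ltW eta_gt0) h.
by rewrite mulrN => h2; rewrite mulNr lerNl (le_trans _ h2)// mulrC.
Qed.

Let zY_bnd z : `|zY z| <= b.
Proof.
have h1 : 1 <= b by rewrite -expR0 ler_expR mulr_ge0// ltW.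
have h2 := q_le z; have h3 : 0 < q z by exact: expR_gt0.
by rewrite ler_norml /zY; apply/andP; split; lra.
Qed.

Let zX_bnd z : `|zX z| <= b. Proof. exact: zY_bnd. Qed.

Let zY_center x : \int[nu]_y zY (x, y) = 0.
Proof.
rewrite bRintegralB; [|exact: bmeas_cst|exact: bmeas_sectionl].
by rewrite bRintegral_cst row subrr.
Qed.

Let zX_center y : \int[mu]_x zX (y, x) = 0.
Proof.
rewrite bRintegralB; [|exact: bmeas_cst|].
  by rewrite bRintegral_cst col subrr.
exact: (bmeas_sectionr y bq).
Qed.

Let Z := two_samples X Y.
Let sX (k : nat) : 'I_n.+1 + 'I_n.+1 := inl (inord k).
Let sY (k : nat) : 'I_n.+1 + 'I_n.+1 := inr (inord k).

(* U1 and U2 are the mean squares, over the sample, of the averages of 1 - q in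
   one variable; U3 and U4 are the same mean squares over mu and nu. *)
Let U1 := mean_square_deviation Z n.+1 sY zY (sample_mean Z n.+1 sX).
Let U2 := mean_square_deviation Z n.+1 sX zX (sample_mean Z n.+1 sY).
Let U3 := mean_square_deviation Z n.+1 sY zY (population_mean mu).
Let U4 := mean_square_deviation Z n.+1 sX zX (population_mean nu).

Let rate : R := 32 * b ^+ 2 / n.+1%:R.

Let law_sX k : (k < n.+1)%N -> has_law (Z (sX k)) mu.
Proof. by move=> _; exact: X_law. Qed.
Let law_sY k : (k < n.+1)%N -> has_law (Z (sY k)) nu.
Proof. by move=> _; exact: Y_law. Qed.

Let inj_sX j k : (j < k < n.+1)%N -> sX j != sX k.
Proof.
move=> /andP[jk kn]; apply/eqP => -[] /(congr1 val) /=.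
by rewrite !inordK// ?(ltn_trans jk)// => e; rewrite e ltnn in jk.
Qed.

Let inj_sY j k : (j < k < n.+1)%N -> sY j != sY k.
Proof.
move=> /andP[jk kn]; apply/eqP => -[] /(congr1 val) /=.
by rewrite !inordK// ?(ltn_trans jk)// => e; rewrite e ltnn in jk.
Qed.

Let U1P : subexponential_at_rate P rate U1.
Proof. by apply: (@subexponential_sample_deviation _ _ _ _ _ _ _ Z n.+1 sY sX nu). Qed.
Let U2P : subexponential_at_rate P rate U2.
Proof. by apply: (@subexponential_sample_deviation _ _ _ _ _ _ _ Z n.+1 sX sY mu). Qed.
Let U3P : subexponential_at_rate P rate U3.
Proof. by apply: (@subexponential_population_deviation _ _ _ _ _ _ _ Z n.+1 sY sX mu nu). Qed.
Let U4P : subexponential_at_rate P rate U4.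
Proof. by apply: (@subexponential_population_deviation _ _ _ _ _ _ _ Z n.+1 sX sY nu mu). Qed.

Let C : R := 4 * expR (24 * eta).

Let C_ge0 : 0 <= C. Proof. by rewrite mulr_ge0// expR_ge0. Qed.

Let p_star := schrodinger_density mu nu pi_star.
Let p_n w := gibbs_density eta (f_n w) (g_n w).

(* the almost sure event on which the losses are bounded by the deviations *)
Let good w := [/\ forall i, enorm (X i w) <= 2^-1,
  forall j, enorm (Y j w) <= 2^-1 &
  forall i j, p_star (X i w, Y j w) = q (X i w, Y j w)].

Let p_starE : {ae (mu \x nu)%E, forall z, p_star z = q z}.
Proof. exact: schrodinger_densityE. Qed.

Let ae_good : {ae P, forall w, good w}.
Proof.
have h1 i : {ae P, forall w, enorm (X i w) <= 2^-1}.
  have [N [mN N0 NP]] := mu_supp.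
  exists (X i @^-1` N); split; first exact: measurable_funPTI.
    exact: etrans (X_law i mN) N0.
  by move=> w /= h; exact: NP.
have h2 j : {ae P, forall w, enorm (Y j w) <= 2^-1}.
  have [N [mN N0 NP]] := nu_supp.
  exists (Y j @^-1` N); split; first exact: measurable_funPTI.
    exact: etrans (Y_law j mN) N0.
  by move=> w /= h; exact: NP.
have h3 i j : {ae P, forall w, p_star (X i w, Y j w) = q (X i w, Y j w)}.
  have [N [mN N0 NP]] := p_starE.
  exists [set w | N (X i w, Y j w)]; split.
  - rewrite -[X in measurable X]setTI.
    have mp : measurable_fun [set: Omega] (fun w => (X i w, Y j w)).
      by apply/measurable_fun_pairP; split.
    exact: mp.
  - rewrite -N0; apply: (@pair_law _ _ _ _ _ _ _ Z mu nu (inl i) (inr j)) => //.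
      exact: X_law.
    exact: Y_law.
  - by move=> w /= h; exact: NP.
have k3 : {ae P, forall w, forall ij : 'I_n.+1 * 'I_n.+1,
    p_star (X ij.1 w, Y ij.2 w) = q (X ij.1 w, Y ij.2 w)}.
  by apply: filter_forall => -[i j]; exact: h3.
have k1 : {ae P, forall w, forall i, enorm (X i w) <= 2^-1}.
  by apply: filter_forall.
have k2 : {ae P, forall w, forall j, enorm (Y j w) <= 2^-1}.
  by apply: filter_forall.
move: k1 k2 k3; apply: filterS3 => w a1 a2 a3; split => // i j.
exact: (a3 (i, j)).
Qed.

(* the errors of q in the marginal conditions of the samples *)
Let devY w u : R := n.+1%:R^-1 * \sum_(j < n.+1) zY (u, Z (sY j) w).
Let devX w v : R := n.+1%:R^-1 * \sum_(i < n.+1) zX (v, Z (sX i) w).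

Let devYE w u : devY w u = average (fun j => 1 - q (u, Y j w)).
Proof.
by congr (_ * _); apply: eq_bigr => j _; rewrite /Z /sY /= inord_val.
Qed.

Let devXE w v : devX w v = average (fun i => 1 - q (X i w, v)).
Proof.
by congr (_ * _); apply: eq_bigr => i _; rewrite /Z /sX /= inord_val.
Qed.

Let U1E w : U1 w = average (fun i => devY w (X i w) ^+ 2).
Proof.
by congr (_ * _); apply: eq_bigr => i _; rewrite /Z /sX /= inord_val.
Qed.

Let U2E w : U2 w = average (fun j => devX w (Y j w) ^+ 2).
Proof.
by congr (_ * _); apply: eq_bigr => j _; rewrite /Z /sY /= inord_val.
Qed.

(* the extension equations make the potentials measurable *)
Let mf_n w : measurable_fun [set: V] (f_n w).
Proof.
have [_ _ fE _] := fg_nP w.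
rewrite (_ : f_n w = fun u => - eta^-1 * ln (n.+1%:R^-1 *
  \sum_(j < n.+1) expR (- eta * sqdist u (Y j w) + eta * g_n w (Y j w)))).
  apply: measurable_funM => //; apply: measurableT_comp => //.
  apply: measurable_funM => //; apply: measurable_sum => j.
  apply: measurableT_comp => //; apply: measurable_funD => //.
  apply: measurable_funM => //.
  exact: (measurableT_comp measurable_sqdist (measurable_pair2 (Y j w))).
apply/funext => u; rewrite -fE expRK; field.
by rewrite gt_eqF.
Qed.

Let mg_n w : measurable_fun [set: V] (g_n w).
Proof.
have [_ _ _ gE] := fg_nP w.
rewrite (_ : g_n w = fun v => - eta^-1 * ln (n.+1%:R^-1 *
  \sum_(i < n.+1) expR (- eta * sqdist (X i w) v + eta * f_n w (X i w)))).
  apply: measurable_funM => //; apply: measurableT_comp => //.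
  apply: measurable_funM => //; apply: measurable_sum => i.
  apply: measurableT_comp => //; apply: measurable_funD => //.
  apply: measurable_funM => //.
  exact: (measurableT_comp measurable_sqdist (measurable_pair1 (X i w))).
apply/funext => v; rewrite -gE expRK; field.
by rewrite gt_eqF.
Qed.

Let mp_n w : measurable_fun [set: V * V] (p_n w).
Proof.
apply: measurableT_comp => //; apply: measurable_funM => //.
apply: measurable_funB; first apply: measurable_funB.
- exact: measurable_sqdist.
- exact: (measurableT_comp (mf_n w) measurable_fst).
- exact: (measurableT_comp (mg_n w) measurable_snd).
Qed.

Let mp_star : measurable_fun [set: V * V] p_star.
Proof.
apply: measurableT_comp => //; rewrite /Radon_Nikodym; case: pselect => [h|_].
  case: cid => r [_ + _] /=; exact: measurable_int.
exact: measurable_cst.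
Qed.

Let pointwise w u v : good w -> enorm u <= 2^-1 -> enorm v <= 2^-1 ->
  (p_n w (u, v) - q (u, v)) ^+ 2 <=
  C * ((U1 w + U2 w) + (devY w u ^+ 2 + devX w v ^+ 2)).
Proof.
move=> [gX gY _] hu hv; have [_ g_mean fE gE] := fg_nP w.
rewrite (_ : p_n w (u, v) = expR (- eta * (capped_cost (u, v) - f_n w u - g_n w v))); last first.
  by rewrite capped_costE.
have -> : U1 w = average (fun i => average (fun j => 1 - q (X i w, Y j w)) ^+ 2).
  by rewrite U1E; congr average; apply/funext => i; rewrite devYE.
have -> : U2 w = average (fun j => average (fun i => 1 - q (X i w, Y j w)) ^+ 2).
  by rewrite U2E; congr average; apply/funext => j; rewrite devXE.
rewrite devYE devXE.
apply: (density_stability eta_gt0 (ltn0Sn n) (c := fun u v => capped_cost (u, v))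
  (DX := [set x | enorm x <= 2^-1]) (DY := [set y | enorm y <= 2^-1])
  (x := fun i => X i w) (y := fun j => Y j w) (f := f_n w) (f0 := f0) (g := g_n w) (g0 := g0)) => //.
- by move=> a a' _ _; exact: capped_cost01.
- by rewrite -[RHS]g_mean Rintegral_empirical.
- move=> x hx; rewrite fE; congr (_ * _); apply: eq_bigr => j _.
  by rewrite capped_costE.
- move=> y hy; rewrite gE; congr (_ * _); apply: eq_bigr => j _.
  by rewrite capped_costE.
Qed.

Let prod_coupling : coupling mu nu (mu \x nu)%E.
Proof.
move=> A mA; split; rewrite /= product_measure1E//.
  exact: etrans (congr1 (fun z => mu A * z)%E (probability_setT nu)) (mule1 _).
exact: etrans (congr1 (fun z => z * nu A)%E (probability_setT mu)) (mul1e _).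
Qed.

Let bdevY w : bmeas (devY w).
Proof.
apply: bmeasM; first exact: bmeas_cst.
by apply: bmeas_sum => j; exact: (bmeas_sectionr _ bzY).
Qed.

Let bdevX w : bmeas (devX w).
Proof.
apply: bmeasM; first exact: bmeas_cst.
by apply: bmeas_sum => j; exact: (bmeas_sectionr _ bzX).
Qed.

Let population_bound w : good w ->
  (L2_dist_sq (mu \x nu) (p_n w) p_star <= (C * (U1 w + U2 w + (U3 w + U4 w)))%:E)%E.
Proof.
move=> gw; rewrite L2_dist_sqE.
pose rho : probability (V * V)%type R := (mu \x nu)%E.
have b1 : bmeas (fun z : V * V => devY w z.1 ^+ 2).
  by apply: (@bmeas_comp _ _ _ _ _ (fun x => devY w x ^+ 2) fst) => //; exact: bmeasX.
have b2 : bmeas (fun z : V * V => devX w z.2 ^+ 2).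
  by apply: (@bmeas_comp _ _ _ _ _ (fun x => devX w x ^+ 2) snd) => //; exact: bmeasX.
have b12 : bmeas (fun z : V * V => devY w z.1 ^+ 2 + devX w z.2 ^+ 2) by exact: bmeasD.
have bc : bmeas (fun z : V * V => U1 w + U2 w + (devY w z.1 ^+ 2 + devX w z.2 ^+ 2)).
  by apply: bmeasD => //; exact: bmeas_cst.
have bh : bmeas (fun z : V * V => C * (U1 w + U2 w + (devY w z.1 ^+ 2 + devX w z.2 ^+ 2))).
  by apply: bmeasM => //; exact: bmeas_cst.
have <- : \int[rho]_z (C * (U1 w + U2 w + (devY w z.1 ^+ 2 + devX w z.2 ^+ 2))) =
    C * (U1 w + U2 w + (U3 w + U4 w)).
  rewrite bRintegralZl//; congr (_ * _).
  rewrite bRintegralD//; last exact: bmeas_cst.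
  rewrite bRintegral_cst; congr (_ + _).
  rewrite bRintegralD//; congr (_ + _).
    apply: (coupling_integral_fst prod_coupling (f := fun x => devY w x ^+ 2)).
    exact: bmeasX.
  apply: (coupling_integral_snd prod_coupling (g := fun x => devX w x ^+ 2)).
  exact: bmeasX.
rewrite (EFin_bRintegral rho bh); apply: ae_ge0_le_integral_lower.
- by apply/measurable_EFinP; exact: bh.1.
- by move=> z; rewrite lee_fin sqr_ge0.
- move=> z; have [_ h1 _ _] := U1P; have [_ h2 _ _] := U2P.
  by rewrite lee_fin mulr_ge0// addr_ge0// addr_ge0// sqr_ge0.
- apply: filterS2 p_starE (coupling_ae prod_coupling mu_supp nu_supp).
  by move=> -[u v] e [hu hv]; rewrite lee_fin e; exact: pointwise.
Qed.

Let empirical_bound w : good w ->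
  (L2_dist_sq (empirical (fun i => X i w) \x empirical (fun j => Y j w))
     (p_n w) p_star <= (C * (2 * U1 w + 2 * U2 w))%:E)%E.
Proof.
move=> gw; have [gX gY pE] := gw; rewrite L2_dist_sqE.
pose F (z : V * V) := ((p_n w z - p_star z) ^+ 2)%:E : \bar R.
have mF : measurable_fun [set: V * V] F.
  by apply/measurable_EFinP; apply: measurable_funX; apply: measurable_funB.
have F0 z : (0 <= F z)%E by rewrite lee_fin sqr_ge0.
have sec x : (\int[empirical (fun j => Y j w)]_y F (x, y) =
    (n.+1%:R^-1)%:E * \sum_(j < n.+1) F (x, Y j w))%E.
  rewrite (@integral_empirical _ _ _ _ _ (fun y => F (x, y)))//.
  exact: measurableT_comp mF (measurable_pair1 x).
rewrite -[leLHS]/(\int[_]_z F z)%E fubini_tonelli1//.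
have mG : measurable_fun [set: V] (fubini_F (empirical (fun j => Y j w)) F).
  exact: measurable_fun_fubini_tonelli_F.
rewrite integral_empirical//; last by move=> u; exact: integral_ge0.
have -> : (\sum_(i < n.+1) fubini_F (empirical (fun j => Y j w)) F (X i w) =
    (\sum_(i < n.+1) average (fun j =>
      (p_n w (X i w, Y j w) - q (X i w, Y j w)) ^+ 2))%:E)%E.
  rewrite -sumEFin; apply: eq_bigr => i _; rewrite /fubini_F sec EFinM -sumEFin.
  by congr (_ * _)%E; apply: eq_bigr => j _; rewrite /F pE.
rewrite -EFinM lee_fin.
apply: (@le_trans _ _ (average (fun i => average (fun j =>
  C * (U1 w + U2 w + (devY w (X i w) ^+ 2 + devX w (Y j w) ^+ 2)))))).
  by apply: average_le => i; apply: average_le => j; exact: pointwise.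
have step i : average (fun j =>
    C * (U1 w + U2 w + (devY w (X i w) ^+ 2 + devX w (Y j w) ^+ 2))) =
    C * (U1 w + U2 w + (devY w (X i w) ^+ 2 + U2 w)).
  by rewrite averageZ !averageD !average_cst// U2E.
rewrite (eq_fun step) averageZ !averageD !average_cst// -U1E.
by rewrite ler_wpM2l//; lra.
Qed.

(* 4 exp(24 eta) is the constant of the deterministic bound, 32 exp(6 eta) / n
   the rate of the four deviations, whose means are at most twice the rate *)
Let const : R := 1024 * expR (30 * eta).

Let constE : C * (8 * rate) = const / n.+1%:R.
Proof.
rewrite /C /rate /const (_ : expR (30 * eta) = expR (24 * eta) * b ^+ 2).
  move: (expR (24 * eta)) (b ^+ 2) (n.+1%:R^-1) => *; ring.
by rewrite /b -expRM_natl -expRD; congr expR; ring.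
Qed.

Lemma expected_L2_bound :
  (\int[P]_w L2_dist_sq (mu \x nu) (p_n w) p_star <= (const / n.+1%:R)%:E)%E.
Proof.
have [m1 p1 i1 _] := U1P; have [m2 p2 i2 _] := U2P.
have [m3 p3 i3 _] := U3P; have [m4 p4 i4 _] := U4P.
have E (U : Omega -> R) : measurable_fun [set: Omega] U ->
  measurable_fun [set: Omega] (EFin \o U) by move=> mU; exact/measurable_EFinP.
apply: (@le_trans _ _ (\int[P]_w (C * (U1 w + U2 w + (U3 w + U4 w)))%:E)%E).
  apply: ae_ge0_le_integral_lower.
  - apply/measurable_EFinP; apply: measurable_funM => //.
    by apply: measurable_funD; apply: measurable_funD.
  - by move=> w; rewrite L2_dist_sqE integral_ge0// => z _; rewrite lee_fin sqr_ge0.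
  - by move=> w; rewrite lee_fin mulr_ge0// !addr_ge0.
  - by apply: filterS ae_good => w; exact: population_bound.
under eq_integral do rewrite EFinM.
rewrite ge0_integralZl_EFin//; last 2 first.
- by move=> w _; rewrite lee_fin !addr_ge0.
- by apply: E; apply: measurable_funD; apply: measurable_funD.
rewrite -constE (EFinM C (8 * rate)); apply: lee_wpmul2l; first by rewrite lee_fin.
under eq_integral do rewrite !EFinD.
rewrite ge0_integralD//=; last 4 first.
- by move=> w _; rewrite adde_ge0 ?lee_fin.
- by apply: emeasurable_funD; exact: E.
- by move=> w _; rewrite adde_ge0 ?lee_fin.
- by apply: emeasurable_funD; exact: E.
rewrite !ge0_integralD//=; try exact: E; try by move=> w _; rewrite lee_fin.
have -> : (8 * rate)%:E = (2 * rate)%:E + (2 * rate)%:E + ((2 * rate)%:E + (2 * rate)%:E) :> \bar R.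
  by rewrite -!EFinD; congr EFin; ring.
exact: (leeD (leeD i1 i2) (leeD i3 i4)).
Qed.

Lemma L2_tail_bound (t : R) : 0 < t ->
  exists A : set Omega,
    [/\ measurable A, ((1 - 16 * expR (- t))%:E <= P A)%E &
      forall w, A w ->
        (L2_dist_sq (empirical (fun i => X i w) \x empirical (fun j => Y j w))
           (p_n w) p_star <= (const * t / n.+1%:R)%:E)%E /\
        (L2_dist_sq (mu \x nu) (p_n w) p_star <= (const * t / n.+1%:R)%:E)%E].
Proof.
move=> t_gt0; have [N [mN N0 goodN]] := ae_good.
have [m1 p1 _ t1] := U1P; have [m2 p2 _ t2] := U2P.
have [m3 p3 _ t3] := U3P; have [m4 p4 _ t4] := U4P.
pose B (U : Omega -> R) := [set w | rate * t < U w].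
have mB (U : Omega -> R) : measurable_fun [set: Omega] U -> measurable (B U).
  move=> mU; have := measurable_fun_ltr (measurable_cst (rate * t)) mU.
  by move=> /(_ measurableT [set true]); rewrite setTI; apply.
pose D := (N `|` (B U1 `|` B U2)) `|` (B U3 `|` B U4).
have mD : measurable D.
  by apply: measurableU; apply: measurableU; rewrite ?mN//; try exact: mB;
    apply: measurableU; exact: mB.
exists (~` D); split; first exact: measurableC.
- rewrite probability_setC// EFinB leeB//.
  have U2' A1 A2 : measurable A1 -> measurable A2 -> (P (A1 `|` A2) <= P A1 + P A2)%E.
    by move=> mA1 mA2; exact: measureU2.
  have P12 : (P (B U1 `|` B U2) <= (2 * expR (- t))%:E + (2 * expR (- t))%:E)%E.
    exact: (le_trans (U2' _ _ (mB _ m1) (mB _ m2)) (leeD (t1 t) (t2 t))).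
  have P34 : (P (B U3 `|` B U4) <= (2 * expR (- t))%:E + (2 * expR (- t))%:E)%E.
    exact: (le_trans (U2' _ _ (mB _ m3) (mB _ m4)) (leeD (t3 t) (t4 t))).
  have mU12 : measurable (B U1 `|` B U2) by apply: measurableU; exact: mB.
  have mU34 : measurable (B U3 `|` B U4) by apply: measurableU; exact: mB.
  have PN : (P (N `|` (B U1 `|` B U2)) <= (2 * expR (- t))%:E + (2 * expR (- t))%:E)%E.
    by apply: le_trans (U2' _ _ mN mU12) _; rewrite N0 add0e.
  apply: le_trans (U2' _ _ (measurableU _ _ mN mU12) mU34) _.
  apply: (le_trans (leeD PN P34)); rewrite -!EFinD lee_fin.
  by have := expR_ge0 (- t); lra.
- move=> w /not_orP[/not_orP[nN /not_orP[n1 n2]] /not_orP[n3 n4]].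
  have gw : good w by apply: contrapT => h; apply: nN; exact: goodN.
  move: n1 n2 n3 n4; rewrite /B /= => /negP + /negP + /negP + /negP.
  rewrite -!leNgt => h1 h2 h3 h4.
  have e : const * t / n.+1%:R = C * (8 * (rate * t)).
    by rewrite mulrAC -constE; ring.
  have r0 : 0 <= rate * t by exact: le_trans (p1 w) h1.
  split.
    apply: (le_trans (empirical_bound gw)); rewrite lee_fin e ler_wpM2l//.
    by lra.
  apply: (le_trans (population_bound gw)); rewrite lee_fin e ler_wpM2l//.
  by lra.
Qed.

End convergence_rates.

Theorem theorem4 (R : realType) (eta : R) (eta_gt0 : 0 < eta) :
  exists c : R,
  forall (d n : nat) (d_gt0 : (0 < d)%N) (n_gt0 : (0 < n)%N)
    (mu nu : probability (d.-tuple R) R)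
    (mu_supp : {ae mu, forall x, enorm x <= 2^-1})
    (nu_supp : {ae nu, forall y, enorm y <= 2^-1})
    (pi_star : probability (d.-tuple R * d.-tuple R)%type R)
    (pi_starP : schrodinger_coupling eta mu nu pi_star)
    (dO : measure_display) (Omega : measurableType dO) (P : probability Omega R)
    (X Y : 'I_n -> {RV P >-> d.-tuple R})
    (X_law : forall i, has_law (X i) mu)
    (Y_law : forall j, has_law (Y j) nu)
    (XY_indep : mutually_independent (two_samples X Y))
    (f_n g_n : Omega -> d.-tuple R -> R)
    (fg_nP : forall w, empirical_potentials eta
       (fun i => X i w) (fun j => Y j w) (f_n w) (g_n w)),
  let p_star := schrodinger_density mu nu pi_star in
  let p_n w := gibbs_density eta (f_n w) (g_n w) in
  let mu_n w := empirical (fun i => X i w) in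
  let nu_n w := empirical (fun j => Y j w) in
  (\int[P]_w L2_dist_sq (mu \x nu) (p_n w) p_star <= (c / n%:R)%:E)%E /\
  forall t : R, 0 < t ->
    exists A : set Omega,
      [/\ measurable A,
          ((1 - 16 * expR (- t))%:E <= P A)%E &
          forall w, A w ->
            (L2_dist_sq (mu_n w \x nu_n w) (p_n w) p_star <= (c * t / n%:R)%:E)%E /\
            (L2_dist_sq (mu \x nu) (p_n w) p_star <= (c * t / n%:R)%:E)%E].
Proof.
exists (1024 * expR (30 * eta)) => d [//|n] _ _ mu nu mu_supp nu_supp pi_star.
move=> pi_starP dO Omega P X Y X_law Y_law XY_indep f_n g_n fg_nP.
have [f0 [g0 [[mf0 mg0 f0_bnd g0_bnd] [row col]]]] :=
  schrodinger_potentials mu nu eta_gt0 measurable_capped_cost capped_cost01.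
split; first exact: (expected_L2_bound eta_gt0 mu_supp nu_supp pi_starP X_law Y_law
  XY_indep fg_nP mf0 mg0 f0_bnd g0_bnd row col).
exact: (L2_tail_bound eta_gt0 mu_supp nu_supp pi_starP X_law Y_law
  XY_indep fg_nP mf0 mg0 f0_bnd g0_bnd row col).
Qed.
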